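(* Let $\boldsymbol\mu=\{\mu_\beta\}_{|\beta|\ge1}$ be a weight sequence with the property that $\mathcal D(\boldsymbol\mu)$ contains a neighborhood of the origin and let $B_1,\ldots,B_n$ be the compressions of $W_1,\ldots,W_n$ to the symmetric weighted Fock space $F_s^2(\boldsymbol\mu)$, respectively. Then the following statements hold. (i) The $n$-tuple $(B_1,\ldots,B_n)$ is unitarily equivalent to $(M_{\lambda_1},\ldots,M_{\lambda_n})$, where $M_{\lambda_i}$ is the multiplication on $\mathbb H^2(\mathcal D(\boldsymbol\mu))$ by the coordinate function $\lambda_i$. (ii) $\sigma_p(B_1^*,\ldots,B_n^* )=\sigma_p(W_1^*,\ldots,W_n^* )=\mathcal D(\boldsymbol\mu)$. (iii) $A\in\{B_1,\ldots,B_n\}'$ if and only if there is a unique multiplier $\varphi$ of $\mathbb H^2(\mathcal D(\boldsymbol\mu))$ such that $M_\varphi=UAU^*$, where the unitary operator $U:F_s^2(\boldsymbol\mu)\to\mathbb H^2(\mathcal D(\boldsymbol\mu))$ is defined by $U(y^{(\mathbf k)}):=\lambda^{\mathbf k}$. (iv) Each $A\in\{B_1,\ldots,B_n\}'$ is uniquely determined by the vector $A1=\sum_{\mathbf k\in\mathbb N_0^n}c_{\mathbf k}y^{(\mathbf k)}\in F_s^2(\boldsymbol\mu)$, and $$A\zeta=\sum_{\mathbf p\in\mathbb N_0^n}\sum_{\mathbf k\in\mathbb N_0^n}c_{\mathbf k}a_{\mathbf p}y^{(\mathbf k+\mathbf p)}\qquad\text{if }\ \zeta=\sum_{\mathbf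 p\in\mathbb N_0^n}a_{\mathbf p}y^{(\mathbf p)}\in F_s^2(\boldsymbol\mu).$$ (v) With these coefficients, $\langle A1,z_\lambda\rangle=\varphi(\lambda):=\sum_{\mathbf k\in\mathbb N_0^n}c_{\mathbf k}\lambda^{\mathbf k}$ and $A^*z_\lambda=\overline{\varphi(\lambda)}z_\lambda$ for any $\lambda\in\mathcal D(\boldsymbol\mu)$.
   Context: $\mathbb F_n^+$ is the unital free semigroup on generators $g_1,\ldots,g_n$ with identity $g_0$; $|\alpha|$ is the length of $\alpha$. $F^2(H_n)$ is the full Fock space, a Hilbert space with orthonormal basis $\{e_\alpha\}_{\alpha\in\mathbb F_n^+}$, $1:=e_{g_0}$. For $\alpha=g_{i_1}\cdots g_{i_k}$: $\lambda_\alpha:=\lambda_{i_1}\cdots\lambda_{i_k}$, $\boldsymbol\mu(\alpha,g_0):=\mu_{g_{i_1}\cdots g_{i_k}}\mu_{g_{i_2}\cdots g_{i_k}}\cdots\mu_{g_{i_k}}$; for $g_0$ both are $1$. Standing assumptions: $\mu_\beta>0$, and for each $i$, $\sup_\alpha\mu_{g_i\alpha}<\infty$ and $\sup_\alpha\boldsymbol\mu(\alpha g_i,g_0)/\boldsymbol\mu(\alpha,g_0)<\infty$. The weighted left multi-shift is $W_ie_\alpha:=\mu_{g_i\alpha}e_{g_i\alpha}$. $\mathcal D(\boldsymbol\mu):=\{\lambda\in\mathbb C^n:\sum_\alpha|\lambda_\alpha|^2/\boldsymbol\mu(\alpha,g_0)^2<\infty\}$; $z_\lambda:=\sum_\alpha\frac{\bar\lambda_\alpha}{\boldsymbol\mu(\alpha,g_0)}e_\alpha$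 for $\lambda\in\mathcal D(\boldsymbol\mu)$. For $\mathbf k\in\mathbb N_0^n$, $\lambda^{\mathbf k}:=\lambda_1^{k_1}\cdots\lambda_n^{k_n}$, $\Lambda_{\mathbf k}:=\{\alpha:\lambda_\alpha=\lambda^{\mathbf k}\ \forall\lambda\in\mathbb C^n\}$, $\omega_{\mathbf k}:=\sum_{\alpha\in\Lambda_{\mathbf k}}\boldsymbol\mu(\alpha,g_0)^{-2}$, $y^{(\mathbf k)}:=\frac1{\omega_{\mathbf k}}\sum_{\alpha\in\Lambda_{\mathbf k}}\frac1{\boldsymbol\mu(\alpha,g_0)}e_\alpha$ (orthogonal vectors, $\|y^{(\mathbf k)}\|=\omega_{\mathbf k}^{-1/2}$). $F_s^2(\boldsymbol\mu)$ is the closed span of the $y^{(\mathbf k)}$, and $B_i:=P_{F_s^2(\boldsymbol\mu)}W_i|_{F_s^2(\boldsymbol\mu)}$. $\mathbb H^2(\mathcal D(\boldsymbol\mu))$ is the Hilbert space of functions $\varphi(\lambda)=\sum_{\mathbf k}c_{\mathbf k}\lambda^{\mathbf k}$ on $\mathcal D(\boldsymbol\mu)$ with $\|\varphi\|^2=\sum_{\mathbf k}|c_{\mathbf k}|^2/\omega_{\mathbf k}<\infty$. A multiplier of $\mathbb H^2(\mathcal D(\boldsymbol\mu))$ is a function $\varphi$ on $\mathcal D(\boldsymbol\mu)$ with $\varphi f\in\mathbb H^2(\mathcal D(\boldsymbol\mu))$ for all $f$ in the space; $M_\varphi f:=\varphi f$. The prime denotes the commutant in $B(F_s^2(\boldsymbol\mu))$.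 $\sigma_p$ of an $n$-tuple is the set of $\zeta\in\mathbb C^n$ for which a common eigenvector $z\neq0$ exists with $i$-th eigenvalue $\zeta_i$. In (iv), the sum is understood as having, for each $\mathbf q\in\mathbb N_0^n$, the coefficient $\sum_{\mathbf k+\mathbf p=\mathbf q}c_{\mathbf k}a_{\mathbf p}$ at $y^{(\mathbf q)}$. *)

(* Defs.v *)
From HB Require Import structures.
From mathcomp Require Import all_boot all_order all_algebra finmap.
From mathcomp Require Import complex.
From mathcomp Require Import all_classical all_reals.
From mathcomp Require Import ereal topology normedtype esum.
From mathcomp.analysis.showcase Require Import summability.
From mathcomp Require Import ring lra.

Set Implicit Arguments.
Unset Strict Implicit.
Unset Printing Implicit Defensive.
Import Order.TTheory GRing.Theory Num.Theory.
Import numFieldNormedType.Exports.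
Import ComplexField.Normc.
Local Open Scope classical_set_scope.
Local Open Scope complex_scope.
Local Open Scope ring_scope.

(* The scalars are the complex numbers R[i]; the synonym R[i]^o only serves to give
   them their normed module structure over themselves. Norms are R[i]-valued. *)
Section weighted_sums.
Variables (R : realType) (T : choiceType).
Implicit Types (w : T -> R) (x y : T -> R[i]).

Definition wsum w x : \bar R := \esum_(i in [set: T]) (normc (x i) ^+ 2 * w i)%:E.

Lemma normc_sqr (z : R[i]) : normc z ^+ 2 = complex.Re z ^+ 2 + complex.Im z ^+ 2.
Proof. by case: z => a b /=; rewrite sqr_sqrtr // addr_ge0 // sqr_ge0. Qed.

Lemma normcD_young (t : R) (a b : R[i]) : 0 < t ->
  normc (a + b) ^+ 2 <= (1 + t) * normc a ^+ 2 + (1 + t^-1) * normc b ^+ 2.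
Proof.
move=> t0; rewrite !normc_sqr; case: a => a1 a2; case: b => b1 b2 /=.
have key (u v : R) : (u + v) ^+ 2 <= (1 + t) * u ^+ 2 + (1 + t^-1) * v ^+ 2.
  have -> : (1 + t) * u ^+ 2 + (1 + t^-1) * v ^+ 2 =
      (u + v) ^+ 2 + t^-1 * (t * u - v) ^+ 2 by field; rewrite gt_eqF.
  by rewrite lerDl mulr_ge0 ?sqr_ge0 // invr_ge0 ltW.
have := key a1 b1; have := key a2 b2; lra.
Qed.

Lemma esumZ (k : R) (f : T -> R) : 0 <= k ->
  \esum_(i in [set: T]) (k * f i)%:E = (k%:E * \esum_(i in [set: T]) (f i)%:E)%E.
Proof.
move=> k0; rewrite /esum -ereal_supZl //; last first.
  by apply/set0P; exists 0%E; exists set0; [exact: fsets_set0 | rewrite fsbig_set0].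
congr ereal_sup; apply/seteqP; split => [_ [A [fA _] <-]|_ [_ [A [fA _] <-] <-]].
  exists (\sum_(i \in A) (f i)%:E)%E; first by exists A.
  by rewrite !fsumEFin // -EFinM mulr_fsumr.
exists A => //.
by rewrite !fsumEFin // -EFinM mulr_fsumr.
Qed.

Lemma wsum_ge0 w x : (forall i, 0 <= w i) -> (0 <= wsum w x)%E.
Proof.
move=> w0; apply: esum_ge0 => i _; rewrite lee_fin mulr_ge0 ?sqr_ge0 //.
Qed.

Lemma wsumZ w a x : (forall i, 0 <= w i) ->
  wsum w (fun i => a * x i) = ((normc a ^+ 2)%:E * wsum w x)%E.
Proof.
move=> w0; rewrite /wsum -esumZ ?sqr_ge0 //.
by apply: eq_esum => i _; rewrite normcM exprMn -mulrA.
Qed.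

Lemma wsum_young w x y (t : R) : (forall i, 0 <= w i) -> 0 < t ->
  (wsum w (fun i => x i + y i)%R <=
    (1 + t)%R%:E * wsum w x + (1 + t^-1)%R%:E * wsum w y)%E.
Proof.
move=> w0 t0; have ti : 0 < t^-1 by rewrite invr_gt0.
have t1 : 0 <= 1 + t by lra.
have t2 : 0 <= 1 + t^-1 by lra.
rewrite /wsum -!esumZ //.
rewrite -esumD; last 2 first.
- by move=> i _; rewrite lee_fin mulr_ge0 // mulr_ge0 ?sqr_ge0.
- by move=> i _; rewrite lee_fin mulr_ge0 // mulr_ge0 ?sqr_ge0.
apply: le_esum => i _; rewrite -EFinD lee_fin.
apply: le_trans (ler_wpM2r (w0 i) (normcD_young _ _ t0)) _.
by rewrite mulrDl -[in leLHS]mulrA -[X in _ + X <= _]mulrA.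
Qed.

Lemma wsum_linfin w a x y : (forall i, 0 <= w i) ->
  (wsum w x < +oo)%E -> (wsum w y < +oo)%E ->
  (wsum w (fun i => a * x i + y i)%R < +oo)%E.
Proof.
move=> w0 wx wy; apply: le_lt_trans (wsum_young _ _ w0 ltr01) _.
rewrite wsumZ //; apply: lte_add_pinfty.
  rewrite muleA -EFinM; apply: lte_mul_pinfty => //.
  by rewrite lee_fin mulr_ge0 ?sqr_ge0.
by apply: lte_mul_pinfty.
Qed.

Lemma wsum_eq0 w x : (forall i, 0 < w i) -> wsum w x = 0%E -> forall i, x i = 0.
Proof.
move=> w0 x0 i; apply: eq0_normc; apply/eqP; rewrite -sqrf_eq0.
have : ((normc (x i) ^+ 2 * w i)%:E <= wsum w x)%E.
  by rewrite /wsum; apply: esum_ge; exists [set i]; rewrite ?fsbig_set1.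
rewrite x0 lee_fin => le0; have /eqP : normc (x i) ^+ 2 * w i = 0.
  by apply/eqP; rewrite eq_le le0 mulr_ge0 ?sqr_ge0 ?(ltW (w0 i)).
by rewrite mulf_eq0 (gt_eqF (w0 i)) orbF.
Qed.

End weighted_sums.

Section l2.
Variables (R : realType) (T : choiceType).

Definition sqsummable (x : T -> R[i]^o) : Prop :=
  (\esum_(i in [set: T]) (normc (x i) ^+ 2)%:E < +oo)%E.

Lemma wsum1 (x : T -> R[i]) :
  wsum (fun=> 1) x = \esum_(i in [set: T]) (normc (x i) ^+ 2)%:E.
Proof. by apply: eq_esum => i _; rewrite mulr1. Qed.

Definition l2_set : {pred T -> R[i]^o} := fun x => `[< sqsummable x >].

Lemma l2_submod_closed : submod_closed l2_set.
Proof.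
split=> [|a x y /asboolP xl /asboolP yl]; apply/asboolP; rewrite /sqsummable -wsum1.
  rewrite (_ : wsum _ _ = 0%E) //; apply: esum1 => i _.
  by rewrite normc0 expr0n mul0r.
by apply: wsum_linfin => //; rewrite wsum1.
Qed.
HB.instance Definition _ := GRing.isSubmodClosed.Build R[i] (T -> R[i]^o) l2_set
  l2_submod_closed.

Record l2 := L2 { l2_fun :> T -> R[i]^o; l2_funP : l2_fun \in l2_set }.
HB.instance Definition _ := [isSub for l2_fun].
HB.instance Definition _ := [Choice of l2 by <:].
HB.instance Definition _ := [SubChoice_isSubLmodule of l2 by <:].

Definition sqnorm (x : l2) : R :=
  fine (\esum_(i in [set: T]) (normc (x i) ^+ 2)%:E)%E.
Definition l2norm (x : l2) : R[i] := (Num.sqrt (sqnorm x))%:C.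

Lemma sqnormE x : (sqnorm x)%:E = wsum (fun=> 1) x.
Proof.
rewrite wsum1 /sqnorm fineK // ge0_fin_numE.
  by have /asboolP := l2_funP x.
by apply: esum_ge0 => i _; rewrite lee_fin sqr_ge0.
Qed.

Lemma sqnorm_ge0 x : 0 <= sqnorm x.
Proof. by rewrite -lee_fin sqnormE wsum_ge0. Qed.

Lemma l2norm_eq0 x : l2norm x = 0 -> x = 0.
Proof.
move=> [] /eqP; rewrite sqrtr_eq0 => x0.
have {}x0 : sqnorm x = 0 by apply/eqP; rewrite eq_le x0 sqnorm_ge0.
apply: val_inj; apply/funext => i; apply: (@wsum_eq0 _ _ (fun=> 1)) => //.
by rewrite -sqnormE x0.
Qed.

Lemma l2normZ (a : R[i]) x : l2norm (a *: x) = `|a| * l2norm x.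
Proof.
rewrite /l2norm (_ : sqnorm (a *: x) = normc a ^+ 2 * sqnorm x); last first.
  by apply: EFin_inj; rewrite EFinM !sqnormE -wsumZ.
rewrite sqrtrM ?sqr_ge0 // sqrtr_sqr ger0_norm ?rmorphM //.
by case: (a) => p q /=; apply: sqrtr_ge0.
Qed.

Lemma l2normD x y : l2norm (x + y) <= l2norm x + l2norm y.
Proof.
rewrite /l2norm -rmorphD lecR.
set X := Num.sqrt (sqnorm x); set Y := Num.sqrt (sqnorm y).
have X0 : 0 <= X by exact: sqrtr_ge0.
have Y0 : 0 <= Y by exact: sqrtr_ge0.
have XE : sqnorm x = X ^+ 2 by rewrite sqr_sqrtr ?sqnorm_ge0.
have YE : sqnorm y = Y ^+ 2 by rewrite sqr_sqrtr ?sqnorm_ge0.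
have [X1|X1] := eqVneq X 0.
  have -> : x = 0 by apply: l2norm_eq0; rewrite /l2norm -/X X1.
  by rewrite add0r X1 add0r.
have [Y1|Y1] := eqVneq Y 0.
  have -> : y = 0 by apply: l2norm_eq0; rewrite /l2norm -/Y Y1.
  by rewrite addr0 Y1 addr0.
have {X1}X1 : 0 < X by rewrite lt0r X1.
have {Y1}Y1 : 0 < Y by rewrite lt0r Y1.
rewrite -(ger0_norm (addr_ge0 X0 Y0)) -sqrtr_sqr; apply: ler_wsqrtr.
have t0 : 0 < Y / X by rewrite divr_gt0.
have := @wsum_young R T (fun=> 1) x y _ (fun=> ler01) t0.
rewrite -!sqnormE -!EFinM -EFinD.
rewrite -(sqnormE (x + y)) lee_fin XE YE => /le_trans; apply.
rewrite le_eqVlt; apply/orP; left; apply/eqP; field.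
by rewrite !gt_eqF.
Qed.

HB.instance Definition _ :=
  Lmodule_isNormed.Build R[i] l2 l2normD l2normZ l2norm_eq0.

End l2.

#[global] Existing Instance totally_filter.

Section generalities.
Variable R : realType.

(* Unconditional summation: convergence along the finite subsets of the index set. *)
Definition has_sum (I : choiceType) (V : normedModType R[i]) (f : I -> V) (l : V) :=
  partial_sum f @ totally --> l.

Definition lin_span (I : Type) (V : lmodType R[i]) (v : I -> V) : set V :=
  [set x | exists s : seq (R[i] * I), x = \sum_(p <- s) p.1 *: v p.2].

Definition inner (T : choiceType) (x y : l2 R T) : R[i] :=
  summability.sum (fun t => x t * (y t)^* : R[i]^o).

(* The vector z with <x, z> = <A x, y> for all x is unique, and it exists for every
   bounded A between Hilbert spaces; 0 is a default value, never used in that case. *)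
Definition adjoint (V W : lmodType R[i]) (dotV : V -> V -> R[i])
    (dotW : W -> W -> R[i]) (A : V -> W) : W -> V :=
  fun y => xget 0 [set z | forall x, dotV x z = dotW (A x) y].

Definition unitary (V W : lmodType R[i]) (dotV : V -> V -> R[i])
    (dotW : W -> W -> R[i]) (U : V -> W) : Prop :=
  [/\ linear U, bijective U & forall x y, dotW (U x) (U y) = dotV x y].

Definition unitarily_equivalent (I : Type) (V W : lmodType R[i])
    (dotV : V -> V -> R[i]) (dotW : W -> W -> R[i])
    (A : I -> V -> V) (B : I -> W -> W) : Prop :=
  exists2 U : V -> W, unitary dotV dotW U & forall i, U \o A i = B i \o U.

Definition bounded_op (V W : normedModType R[i]) (A : V -> W) : Prop :=
  linear A /\ continuous A.

Definition commutant (I : Type) (V : normedModType R[i]) (B : I -> V -> V) :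
    set (V -> V) :=
  [set A | bounded_op A /\ forall i, A \o B i = B i \o A].

Definition point_spectrum n (V : lmodType R[i]) (A : 'I_n -> V -> V) :
    set 'rV[R[i]^o]_n :=
  [set z | exists x : V, x != 0 /\ forall i, A i x = z ord0 i *: x].

Lemma closure_submod_closed (V : normedModType R[i]) (S : set V) :
  submod_closed (fun x : V => `[< S x >]) ->
  submod_closed (fun x : V => `[< closure S x >]).
Proof.
move=> [/asboolP S0 Slin]; split=> [|a x y /asboolP xS /asboolP yS]; apply/asboolP.
  exact: subset_closure.
move=> B /nbhs_ballP[e /= e0 eB].
have ha : 0 < `|a| + 1 by rewrite ltr_wpDl.
have d0 : 0 < e / 2 / (`|a| + 1) by rewrite !divr_gt0.
have [x' [Sx' xx']] := xS _ (nbhsx_ballx x _ d0).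
have e2 : 0 < e / 2 by rewrite divr_gt0.
have [y' [Sy' yy']] := yS _ (nbhsx_ballx y _ e2).
exists (a *: x' + y'); split.
  by apply/asboolP/Slin; apply/asboolP.
apply: eB; move: xx' yy'; rewrite -!ball_normE /= => xx' yy'.
rewrite opprD addrACA -scalerBr (splitr e).
apply: le_lt_trans (ler_normD _ _) _; apply: ler_ltD => //.
rewrite normrZ; apply: le_trans (_ : (`|a| + 1) * `|x - x'| <= _).
  by rewrite ler_wpM2r // lerDl.
by rewrite mulrC -ler_pdivlMr // ltW.
Qed.

Lemma lin_span_submod_closed (I : Type) (V : lmodType R[i]) (v : I -> V) :
  submod_closed (fun x : V => `[< lin_span v x >]).
Proof.
split=> [|a x y /asboolP[s ->] /asboolP[t ->]]; apply/asboolP.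
  by exists [::]; rewrite big_nil.
exists ([seq (a * p.1, p.2) | p <- s] ++ t).
rewrite big_cat big_map scaler_sumr; congr (_ + _).
by apply: eq_bigr => p _; rewrite scalerA.
Qed.

Lemma partial_sum_lin (I : choiceType) (V : lmodType R[i]) (a : R[i]) (f g : I -> V) F :
  partial_sum (fun i => a *: f i + g i) F = a *: partial_sum f F + partial_sum g F.
Proof. by rewrite /partial_sum scaler_sumr -big_split. Qed.

Lemma has_sum_lin (I : choiceType) (V : normedModType R[i]) (a : R[i])
    (f g : I -> V) (l m : V) :
  has_sum f l -> has_sum g m -> has_sum (fun i => a *: f i + g i) (a *: l + m).
Proof.
move=> fl gm; rewrite /has_sum.
rewrite (_ : partial_sum _ = fun F => a *: partial_sum f F + partial_sum g F).
  by apply: cvgD gm; apply: cvgZl_tmp.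
by apply/funext => F; rewrite partial_sum_lin.
Qed.

End generalities.

Section words.
Variables (R : realType) (n : nat).

(* [:: i_1; ...; i_k] is the word g_(i_1) ... g_(i_k), and [::] is the identity g_0. *)
Definition word := seq 'I_n.
Definition multi_index := {ffun 'I_n -> nat}.
Implicit Types (a b : word) (k : multi_index) (l : 'rV[R[i]^o]_n).

Definition word_eval l a : R[i] := \prod_(i <- a) l ord0 i.
Definition monomial l k : R[i] := \prod_(i < n) l ord0 i ^+ k i.

(* Lambda_k. It is finite (finite_Lambda), so the \sum_(a \in _) over it below are
   genuine sums. *)
Definition abelianization_class k : set word :=
  [set a | forall l, word_eval l a = monomial l k].
Local Notation Lambda := abelianization_class.

Lemma size_Lambda k a : Lambda k a -> size a = (\sum_(i < n) k i)%N.
Proof.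
move=> /(_ (const_mx 2)); rewrite /word_eval /monomial.
under eq_bigr do rewrite mxE.
rewrite big_const_seq count_predT iter_mulr_1.
under eq_bigr do rewrite mxE.
rewrite -(big_morph (fun m => (2 : R[i]) ^+ m) (exprD 2) (expr0 2)) -!natrX.
by move=> /eqP; rewrite eqr_nat eqn_exp2l // => /eqP.
Qed.

Lemma finite_Lambda k : finite_set (Lambda k).
Proof.
apply: (@sub_finite_set _ _ (range (fun t : (\sum_(i < n) k i)%N.-tuple 'I_n => val t))).
  by move=> a /size_Lambda /eqP sa; exists (Tuple sa).
exact/finite_image/finite_finset.
Qed.

(* The product bold-mu(a, g_0) of the weights of the nonempty suffixes of a. *)
Fixpoint weight_prod (mu : word -> R) a : R :=
  if a is i :: b then mu a * weight_prod mu b else 1.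

(* Weight sequences with the standing boundedness assumptions. They are indexed by the
   nonempty words: the value at [::] is unconstrained and never used. *)
Record weight := Weight {
  weight_fun :> word -> R;
  weight_gt0 : forall b, b != [::] -> 0 < weight_fun b;
  weight_cons_bounded : forall i, has_ubound (range (fun a => weight_fun (i :: a)));
  weight_rcons_bounded : forall i, has_ubound
    (range (fun a => weight_prod weight_fun (rcons a i) / weight_prod weight_fun a)) }.

End words.

Section weighted_Fock.
Variables (R : realType) (n : nat) (mu : weight R n).
Local Notation word := (word n).
Local Notation multi_index := (multi_index n).
Local Notation Fock := (l2 R word).
Local Notation bmu := (weight_prod mu).
Implicit Types (a b : word) (k : multi_index).

Lemma weight_prod_gt0 a : 0 < bmu a.
Proof. by elim: a => //= i a IH; rewrite mulr_gt0 // weight_gt0. Qed.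

Lemma basis_subproof a : (fun b => (b == a)%:R : R[i]^o) \in @l2_set R word.
Proof.
apply/asboolP; rewrite /sqsummable.
rewrite (_ : esum _ _ = \esum_(b in [set a]) (1%:E : \bar R)); last first.
  rewrite [RHS]esum_mkcond; apply: eq_esum => b _.
  case: (b =P a) => [->|ba]; first by rewrite mem_set // normc1 expr1n.
  by rewrite memNset // normc0 expr0n.
by rewrite esum_set1 ?ltry // lee_fin.
Qed.
Definition fock_basis a : Fock := L2 (basis_subproof a).

(* W_i in coordinates; left_shift_basis gives its action on the basis. *)
Definition left_shift_fun (i : 'I_n) (x : word -> R[i]^o) : word -> R[i]^o :=
  fun a => if a is j :: b then (if j == i then (mu a)%:C * x b else 0) else 0.

Lemma left_shift_subproof i (x : Fock) : left_shift_fun i x \in @l2_set R word.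
Proof.
apply/asboolP; rewrite /sqsummable.
have [M Mub] := weight_cons_bounded mu i.
have muM b : normc (mu (i :: b))%:C ^+ 2 <= M ^+ 2.
  have m0 : 0 <= mu (i :: b) by rewrite ltW // weight_gt0.
  have mM : mu (i :: b) <= M by apply: Mub; exists b.
  by rewrite normc_sqr /= expr0n addr0 lerXn2r // nnegrE (le_trans m0).
apply: (@le_lt_trans _ _
   (\esum_(a in (cons i) @` [set: word]) (normc (left_shift_fun i x a) ^+ 2)%:E)).
  rewrite [leRHS]esum_mkcond; apply: le_esum => a _.
  case: ifPn => // /negP nin.
  rewrite (_ : left_shift_fun i x a = 0) ?normc0 ?expr0n //.
  case: a nin => //= j b nin; case: eqP => // ji.
  by exfalso; apply: nin; rewrite inE; exists b; rewrite ?ji.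
rewrite esum_image; last by move=> b c _ _ [].
apply: (@le_lt_trans _ _ (\esum_(b in [set: word]) (M ^+ 2 * normc (x b) ^+ 2)%:E)).
  apply: le_esum => b _; rewrite lee_fin /= eqxx normcM exprMn.
  by rewrite ler_wpM2r // sqr_ge0.
rewrite esumZ ?sqr_ge0 //; apply: lte_mul_pinfty; rewrite ?lee_fin ?sqr_ge0 //.
by have /asboolP := l2_funP x.
Qed.
Definition left_shift (i : 'I_n) (x : Fock) : Fock := L2 (left_shift_subproof i x).

Lemma left_shift_basis i a :
  left_shift i (fock_basis a) = (mu (i :: a))%:C *: fock_basis (i :: a).
Proof.
apply: val_inj; apply/funext => -[|j b] /=.
  by rewrite -[RHS]/(_ * _) mulr0.
rewrite -[RHS]/(_ * _) /= eqseq_cons; case: eqP => [->|] /=; last by rewrite mulr0.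
by case: eqP => [->|]; rewrite ?mulr0.
Qed.

(* D(mu). *)
Definition weight_domain : set 'rV[R[i]^o]_n :=
  [set l | (\esum_(a in [set: word])
              (normc (word_eval l a) ^+ 2 / bmu a ^+ 2)%:E < +oo)%E].
Local Notation D := weight_domain.

Lemma kernel_subproof (l : D) :
  (fun a => (word_eval (val l) a)^* / (bmu a)%:C : R[i]^o) \in @l2_set R word.
Proof.
apply/asboolP; rewrite /sqsummable.
have := valP l; rewrite inE /= => /le_lt_trans; apply.
apply: le_esum => a _; rewrite lee_fin normcM normcV exprMn exprVn.
rewrite !normc_sqr /= expr0n addr0.
by case: (word_eval _ _) => u v /=; rewrite sqrrN.
Qed.
(* z_lambda. *)
Definition eigen_kernel (l : D) : Fock := L2 (kernel_subproof l).

(* omega_k. *)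
Definition class_weight k : R :=
  \sum_(a \in abelianization_class R k) (bmu a ^+ 2)^-1.
Local Notation omega := class_weight.

(* y^(k); as an element of the symmetric Fock space it is sym_basis k. *)
Definition class_vector k : Fock :=
  ((omega k)^-1)%:C *:
    \sum_(a \in abelianization_class R k) ((bmu a)^-1)%:C *: fock_basis a.

(* F_s^2(mu), the closed span of the y^(k), with the structure induced by the Fock space. *)
Definition symFock_set : {pred Fock} :=
  fun x => `[< closure (lin_span class_vector) x >].

Lemma symFock_submod_closed : submod_closed symFock_set.
Proof. exact/closure_submod_closed/lin_span_submod_closed. Qed.
HB.instance Definition _ := GRing.isSubmodClosed.Build R[i] Fock symFock_set
  symFock_submod_closed.

Record symFock := SymFock { symFock_val :> Fock; symFockP : symFock_val \in symFock_set }.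
HB.instance Definition _ := [isSub for symFock_val].
HB.instance Definition _ := [Choice of symFock by <:].
HB.instance Definition _ := [SubChoice_isSubLmodule of symFock by <:].

Definition symFock_norm (x : symFock) : R[i] := `|symFock_val x|.
Lemma symFock_normD x y : symFock_norm (x + y) <= symFock_norm x + symFock_norm y.
Proof. exact: ler_normD. Qed.
Lemma symFock_normZ (c : R[i]) x : symFock_norm (c *: x) = `|c| * symFock_norm x.
Proof. exact: normrZ. Qed.
Lemma symFock_norm_eq0 x : symFock_norm x = 0 -> x = 0.
Proof. by move=> /normr0_eq0 x0; apply: val_inj. Qed.
HB.instance Definition _ := Lmodule_isNormed.Build R[i] symFock
  symFock_normD symFock_normZ symFock_norm_eq0.

Lemma class_vector_in k : class_vector k \in symFock_set.
Proof.
apply/asboolP; apply: subset_closure.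
by exists [:: (1, k)]; rewrite big_seq1 scale1r.
Qed.
Definition sym_basis k : symFock := SymFock (class_vector_in k).

Lemma Lambda0 : abelianization_class R (0 : multi_index) = [set [::]].
Proof.
apply/seteqP; split => [a /size_Lambda|_ -> l].
  by under eq_bigr do rewrite ffunE; rewrite big1_eq => /size0nil.
rewrite /word_eval /monomial big_nil big1 // => i _.
by rewrite ffunE expr0.
Qed.

Lemma class_vector0 : class_vector 0 = fock_basis [::].
Proof.
by rewrite /class_vector /class_weight Lambda0 !fsbig_set1 /= expr1n !invr1 !scale1r.
Qed.

Lemma vacuum_in : fock_basis [::] \in symFock_set.
Proof. by rewrite -class_vector0 class_vector_in. Qed.
Definition vacuum : symFock := SymFock vacuum_in.

Definition sym_inner (x y : symFock) : R[i] := inner x y.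

(* The orthogonal projection onto F_s^2(mu). *)
Definition sym_proj (x : Fock) : symFock :=
  xget 0 [set y : symFock | forall z : symFock, inner (x - y) z = 0].

(* B_i. *)
Definition sym_shift (i : 'I_n) : symFock -> symFock :=
  fun x => sym_proj (left_shift i x).

Definition sym_expansion (x : symFock) (c : multi_index -> R[i]) : Prop :=
  has_sum (fun k => c k *: sym_basis k) x.

Definition power_series (c : multi_index -> R[i]) (f : D -> R[i]^o) : Prop :=
  forall l : D, has_sum (fun k => c k * monomial (val l) k : R[i]^o) (f l).

(* f is in H^2(D(mu)) with coefficient family c. *)
Definition hardy_coef (f : D -> R[i]^o) : set (multi_index -> R[i]) :=
  [set c | (\esum_(k in [set: multi_index])
              (normc (c k) ^+ 2 / omega k)%:E < +oo)%E /\ power_series c f].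

Definition hardy_set : {pred D -> R[i]^o} := fun f => `[< exists c, hardy_coef f c >].

Lemma omega_ge0 k : 0 <= omega k.
Proof. by apply: fsumr_ge0 => a _; rewrite invr_ge0 sqr_ge0. Qed.

Lemma hardy_submod_closed : submod_closed hardy_set.
Proof.
have w0 k : 0 <= (omega k)^-1 by rewrite invr_ge0 omega_ge0.
split=> [|a f g /asboolP[c [cs fc]] /asboolP[d [ds gd]]]; apply/asboolP.
  exists (fun=> 0); split.
    rewrite (_ : esum _ _ = 0%E) //; apply: esum1 => k _.
    by rewrite normc0 expr0n mul0r.
  move=> l; rewrite /has_sum (_ : partial_sum _ = fun=> 0).
    exact: cvg_cst.
  by apply/funext => F; rewrite /partial_sum big1 // => i _; rewrite mul0r.
exists (fun k => a * c k + d k); split; first exact: wsum_linfin.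
move=> l; rewrite (_ : (fun _ => _) = (fun k => a *: (c k * monomial (val l) k : R[i]^o)
    + (d k * monomial (val l) k : R[i]^o))); first exact: has_sum_lin.
by apply/funext => k; rewrite mulrDl -mulrA.
Qed.
HB.instance Definition _ := GRing.isSubmodClosed.Build R[i] (D -> R[i]^o) hardy_set
  hardy_submod_closed.

Record hardy := Hardy { hardy_fun :> D -> R[i]^o; hardyP : hardy_fun \in hardy_set }.
HB.instance Definition _ := [isSub for hardy_fun].
HB.instance Definition _ := [Choice of hardy by <:].
HB.instance Definition _ := [SubChoice_isSubLmodule of hardy by <:].

(* The coefficient family of f: it is unique when D(mu) is a neighborhood of the
   origin, and hardy_inner is meant under this hypothesis. *)
Definition coef (f : hardy) : multi_index -> R[i] := xget (fun=> 0) (hardy_coef f).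

Definition hardy_inner (f g : hardy) : R[i] :=
  summability.sum (fun k => coef f k * (coef g k)^* / (omega k)%:C : R[i]^o).

Definition multiplier (phi : D -> R[i]^o) : Prop :=
  forall f : hardy, (fun l => phi l * f l : R[i]^o) \in hardy_set.

(* M_phi; the default value 0 of insubd is never taken when phi is a multiplier. *)
Definition mult_op (phi : D -> R[i]^o) (f : hardy) : hardy :=
  insubd (0 : hardy) (fun l => phi l * f l : R[i]^o).

Definition coordinate (i : 'I_n) : D -> R[i]^o := fun l => val l ord0 i.

(* U is unitary and maps y^(k) to the function lambda |-> lambda^k. *)
Definition monomial_unitary (U : symFock -> hardy) : Prop :=
  unitary sym_inner hardy_inner U /\
  forall k l, U (sym_basis k) l = monomial (val l) k.

End weighted_Fock.

(* Main.v *)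
Require Import Defs.
From HB Require Import structures.
From mathcomp Require Import all_boot all_order all_algebra finmap.
From mathcomp Require Import complex.
From mathcomp Require Import all_classical all_reals.
From mathcomp Require Import ereal topology normedtype esum.
From mathcomp.analysis.showcase Require Import summability.
From mathcomp Require Import ring lra zify.

Set Implicit Arguments.
Unset Strict Implicit.
Unset Printing Implicit Defensive.
Import Order.TTheory GRing.Theory Num.Theory.
Import numFieldNormedType.Exports.
Import ComplexField.Normc.
Local Open Scope classical_set_scope.
Local Open Scope complex_scope.
Local Open Scope ring_scope.

(* The vectors y^(k) form an orthogonal basis of F_s^2(mu), so U x := <x, z_lambda>
   sends y^(k) to lambda^k, and it is a unitary onto H^2(D(mu)) once a power series is
   known to determine its coefficients near the origin. Since F_s^2(mu) is invariant
   under W_i^*, with W_i^* z_lambda = conj(lambda_i) z_lambda, U carries B_i to the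
   multiplication by lambda_i, and joint eigenvectors are computed coordinatewise.
   An operator A commutes with the B_i iff <A x, z_lambda> = phi(lambda) <x, z_lambda>
   with phi = U(A 1): this holds for x = y^(k) = B^k 1, hence everywhere by density.
   Conversely, to see that U^* M_phi U is bounded: multiplication by phi does not lower
   the order of vanishing at the origin, so the q-th coefficient of the image of x only
   involves the coefficients of x of degree at most |q|. The norm of the image is thus
   a supremum of continuous seminorms, and Baire's theorem applies. *)

(** The delicate point is the order of vanishing of a product. The available information about phi
    times [sym_eval x] is its size: near the origin a bounded factor times one of order s^(d+1) is
    again of order s^(d+1). This growth has to be turned back into vanishing coefficients in [n]
    variables, where the monomials of one degree could cancel each other. Restricting to a curve on
    which all monomials of low degree have different orders makes the least surviving term dominate.
    The same argument with constant 0 gives uniqueness of power series coefficients. The absolute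
    convergence it requires comes from pairing with the kernel at the diagonal point (r, ..., r),
    which lies in the domain for small r. The finite dependence of coefficients obtained in this way
    serves twice: for boundedness, and for the convolution formula of (iv). *)

Lemma big_fsetU_disjoint (I : choiceType) (V : nmodType) (F G : {fset I}) (f : I -> V) :
  [disjoint F & G]%fset ->
  \sum_(i <- (F `|` G)%fset) f i = \sum_(i <- F) f i + \sum_(i <- G) f i.
Proof.
move=> dFG; rewrite -big_cat /=; apply/perm_big/uniq_perm => //.
  rewrite cat_uniq !fset_uniq andbT /=; apply/hasPn => i iG.
  by apply: contraL iG => /(fdisjointP dFG).
by move=> i; rewrite inE mem_cat.
Qed.

Lemma sum_fsetD (I : choiceType) (V : zmodType) (F G : {fset I}) (f : I -> V) :
  (F `<=` G)%fset ->
  \sum_(i <- G) f i = \sum_(i <- F) f i + \sum_(i <- (G `\` F)%fset) f i.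
Proof.
move=> sFG; rewrite -{1}(fsetID F G) big_fsetU_disjoint; last first.
  by apply/fdisjointP => i; rewrite !inE => /andP[_ ->].
by rewrite (fsetIidPr sFG).
Qed.

(** * Unconditional sums *)

Section has_sum.
Variable R : realType.

Lemma normc_ge0 (z : R[i]) : 0 <= normc z.
Proof. by case: z => a b; apply: sqrtr_ge0. Qed.

Lemma normC_normc (z : R[i]) : `|z| = (normc z)%:C.
Proof. exact: erefl. Qed.

Lemma posC (e : R[i]) : 0 < e -> exists2 d : R, 0 < d & e = d%:C.
Proof.
case: e => a b; rewrite ltcE /= => /andP[/eqP -> a0].
by exists a.
Qed.

Lemma partial_sumE (I : choiceType) (V : zmodType) (f : I -> V) (F : {fset I}) :
  partial_sum f F = \sum_(i <- F) f i.
Proof. by rewrite /partial_sum big_seq_fsetE. Qed.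

Lemma has_sumP (I : choiceType) (V : normedModType R[i]) (f : I -> V) (l : V) :
  has_sum f l <-> forall e : R, 0 < e -> exists F0 : {fset I},
    forall F : {fset I}, (F0 `<=` F)%fset -> `|l - \sum_(i <- F) f i| <= e%:C.
Proof.
rewrite /has_sum; split=> [/cvgrPdist_le fl e e0|fl].
  have /fl : 0 < e%:C by rewrite ltcR.
  case=> F0 _ F0P; exists F0 => F /F0P /=.
  by rewrite partial_sumE.
apply/cvgrPdist_le => _ /posC[e e0 ->].
have [F0 F0P] := fl _ e0; exists F0 => // F /= /F0P.
by rewrite partial_sumE.
Qed.

Lemma has_sum_unique (I : choiceType) (V : normedModType R[i]) (f : I -> V) (l m : V) :
  has_sum f l -> has_sum f m -> l = m.
Proof. by move=> fl fm; exact: (cvg_unique _ fl fm). Qed.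

Lemma has_sum_sum (I : choiceType) (V : normedModType R[i]) (f : I -> V) (l : V) :
  has_sum f l -> summability.sum f = l.
Proof. by move=> fl; apply: cvg_lim. Qed.

Lemma has_sum_fin (I : choiceType) (V : normedModType R[i]) (f : I -> V) (F : {fset I}) :
  (forall i, i \notin F -> f i = 0) -> has_sum f (\sum_(i <- F) f i).
Proof.
move=> f0; apply/has_sumP => e e0; exists F => G FG.
rewrite (_ : \sum_(i <- G) f i = \sum_(i <- F) f i) ?subrr ?normr0 ?ler0c ?ltW //.
by apply/esym/big_fset_incl => // i _ /f0.
Qed.

Lemma has_sum_single (I : choiceType) (V : normedModType R[i]) (f : I -> V) (j : I) :
  (forall i, i != j -> f i = 0) -> has_sum f (f j).
Proof.
move=> f0; have -> : f j = \sum_(i <- [fset j]%fset) f i by rewrite big_seq_fset1.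
by apply: has_sum_fin => i; rewrite inE; exact: f0.
Qed.

Lemma has_sum_map (I : choiceType) (V W : normedModType R[i]) (L : V -> W) (f : I -> V) (l : V) :
  linear L -> continuous L -> has_sum f l -> has_sum (L \o f) (L l).
Proof.
move=> Llin Lc fl; rewrite /has_sum.
have -> : partial_sum (L \o f) = L \o partial_sum f.
  pose L' : {linear V -> W} := HB.pack L (GRing.isLinear.Build _ _ _ _ _ Llin).
  by apply/funext => F; rewrite /partial_sum /= -[L]/(L' : V -> W) linear_sum.
by apply: continuous_cvg; [exact: Lc|].
Qed.

(** Indices that [h] misses contribute nothing. This is what lets a sum over all words be taken over
    words with a fixed first letter. *)
Lemma has_sum_reindex (I J : choiceType) (V : normedModType R[i]) (h : J -> I) (f : I -> V)
    (l : V) : injective h -> (forall i, ~ range h i -> f i = 0) ->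
  has_sum f l <-> has_sum (f \o h) l.
Proof.
move=> hI f0.
(* In either case every index of [F] reached by [h] already comes from [G], so enlarging the sum
   adds zeros only. *)
have key (F : {fset I}) (G : {fset J}) :
    (F `<=` h @` G)%fset \/ (h @^-1` [set` F] `<=` [set` G]) ->
    \sum_(j <- G) f (h j) = \sum_(i <- (F `|` (h @` G))%fset) f i.
  move=> FG; have -> : \sum_(j <- G) f (h j) = \sum_(i <- (h @` G)%fset) f i.
    by rewrite big_imfset //= => ? ? _ _ /hI.
  apply: big_fset_incl; first exact: fsubsetUr.
  move=> i; rewrite inE => /orP[iF|->//] ni; apply: f0 => -[j _ ji].
  case: FG => [/fsubsetP/(_ _ iF)|]; first by rewrite (negbTE ni).
  move=> /(_ j); rewrite /= ji => /(_ iF) jG.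
  by move: ni; rewrite -ji in_imfset.
split=> /has_sumP fl; apply/has_sumP => e /fl[F0 F0P].
  have fin : finite_set (h @^-1` [set` F0]).
    by apply: finite_preimage => // x y _ _ /hI.
  exists (fset_set (h @^-1` [set` F0])) => G sG.
  rewrite (@key F0) ?F0P ?fsubsetUl //; right => j jF.
  by apply: (fsubsetP sG); rewrite in_fset_set // inE.
exists [fset h j | j in F0]%fset => G sG.
pose G' := fset_set (h @^-1` [set` G]).
have fin : finite_set (h @^-1` [set` G]).
  by apply: finite_preimage => // x y _ _ /hI.
have -> : \sum_(i <- G) f i = \sum_(j <- G') f (h j).
  rewrite (@key G); last by right => j jG; rewrite /= in_fset_set // inE.
  apply: big_fset_incl; first exact: fsubsetUl.
  move=> i; rewrite inE => /orP[->//|/imfsetP[j /= jG ->]] /negP; case.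
  by move: jG; rewrite in_fset_set // inE.
apply: F0P; apply/fsubsetP => j jF; rewrite in_fset_set // inE /=.
by apply: (fsubsetP sG); rewrite in_imfset.
Qed.

Lemma normr_Re (V : normedModType R[i]) (v : V) : `|v| = (complex.Re `|v|)%:C.
Proof. by rewrite RRe_real ?ger0_real. Qed.

Lemma has_sum_le (I : choiceType) (V : normedModType R[i]) (f : I -> V) (l : V) (M : R) :
  has_sum f l -> (forall F : {fset I}, `|\sum_(i <- F) f i| <= M%:C) -> `|l| <= M%:C.
Proof.
move=> /has_sumP fl fM.
rewrite normr_Re lecR; apply/ler_addgt0Pr => e e0.
have [F0 /(_ F0 (fsubset_refl _)) F0P] := fl _ e0.
rewrite -lecR -normr_Re rmorphD /= -[l](subrK (\sum_(i <- F0) f i)) addrC.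
by apply: le_trans (ler_normD _ _) _; rewrite lerD.
Qed.

End has_sum.

(** * Nonnegative families through their finite partial sums *)

Section nonneg_sums.
Variables (R : realType) (I : choiceType) (u : I -> R).
Hypothesis u_ge0 : forall i, 0 <= u i.

Lemma le_esum_fset (F : {fset I}) :
  ((\sum_(i <- F) u i)%:E <= \esum_(i in [set: I]) (u i)%:E)%E.
Proof.
apply: esum_ge; exists [set` F]; first by split => //; exact: finite_fset.
by rewrite fsumEFin // fsbig_finite // set_fsetK.
Qed.

Lemma esum_le_fset (M : R) : (forall F : {fset I}, \sum_(i <- F) u i <= M) ->
  (\esum_(i in [set: I]) (u i)%:E <= M%:E)%E.
Proof.
move=> uM; apply: ge_ereal_sup => _ [A [Afin _] <-].
by rewrite fsumEFin // fsbig_finite // lee_fin.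
Qed.

Lemma esum_ltyP : (\esum_(i in [set: I]) (u i)%:E < +oo)%E <->
  exists M, forall F : {fset I}, \sum_(i <- F) u i <= M.
Proof.
split=> [ulty|[M /esum_le_fset]]; last by move=> /le_lt_trans -> //; rewrite ltry.
exists (fine (\esum_(i in [set: I]) (u i)%:E)%E) => F.
rewrite -lee_fin fineK ?le_esum_fset // ge0_fin_numE // esum_ge0 // => i _.
by rewrite lee_fin.
Qed.

(** Take [F0] with partial sum within [e] of the supremum: a set disjoint from it can add at most
    [e]. *)
Lemma nonneg_tail (M : R) : (forall F : {fset I}, \sum_(i <- F) u i <= M) ->
  forall e, 0 < e -> exists F0 : {fset I}, forall F : {fset I},
    [disjoint F & F0]%fset -> \sum_(i <- F) u i <= e.
Proof.
move=> uM e e0; pose S := [set \sum_(i <- F) u i | F in [set: {fset I}]].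
have Ssup : has_sup S.
  by split; [exists (\sum_(i <- fset0) u i), fset0 | exists M => _ [F _ <-]].
have [_ [F0 _ <-] F0e] := sup_adherent e0 Ssup.
exists F0 => F dF; have : \sum_(i <- (F `|` F0)%fset) u i <= sup S.
  by apply: (sup_upper_bound Ssup); exists (F `|` F0)%fset.
rewrite big_fsetU_disjoint //; lra.
Qed.

End nonneg_sums.

(** * Completeness and the Cauchy criterion for unconditional sums *)

Section completeness.
Variable R : realType.

(** Stated for filters, so as to cover both sums along finite index sets and the sequence of ball
    centers in Baire's argument. *)
Definition complete_space (V : normedModType R[i]) : Prop :=
  forall F : set_system V, ProperFilter F -> cauchy F -> cvg F.

Lemma summation_cauchy (I : choiceType) (V : normedModType R[i]) (f : I -> V) :
  complete_space V -> (forall e : R, 0 < e -> exists F0 : {fset I}, forall F : {fset I},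
    [disjoint F & F0]%fset -> `|\sum_(i <- F) f i| <= e%:C) ->
  exists l, has_sum f l.
Proof.
move=> Vc fC; suff : cvg (partial_sum f @ totally) by exists (lim (partial_sum f @ totally)).
apply: Vc; apply: cauchy_exP => _ /posC[e e0 ->].
have e20 : 0 < e / 2 by rewrite divr_gt0.
have [F0 F0P] := fC _ e20.
exists (partial_sum f F0); exists F0 => // F /= sF.
rewrite -ball_normE /= distrC !partial_sumE.
have -> : \sum_(i <- F) f i - \sum_(i <- F0) f i = \sum_(i <- (F `\` F0)%fset) f i.
  by rewrite (sum_fsetD _ sF) addrAC subrr add0r.
apply: le_lt_trans (F0P _ _) _; last by rewrite ltcR; lra.
by apply/fdisjointP => i; rewrite !inE => /andP[].
Qed.

Lemma normc_Re_le (z : R[i]) : `|complex.Re z| <= normc z.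
Proof. by rewrite -lecR; exact: complex.normc_ge_Re. Qed.

Lemma normc_Im_le (z : R[i]) : `|complex.Im z| <= normc z.
Proof.
case: z => a b /=; rewrite -sqrtr_sqr ler_wsqrtr // lerDr sqr_ge0 //.
Qed.

Lemma normc_le (z : R[i]) : normc z <= `|complex.Re z| + `|complex.Im z|.
Proof.
rewrite -(@ler_pXn2r _ 2) // ?nnegrE ?addr_ge0 //.
  rewrite normc_sqr sqrrD !real_normK ?num_real // lerD2r lerDl.
  by rewrite mulrn_wge0 // mulr_ge0.
exact: normc_ge0.
Qed.

Lemma complex_complete : complete_space R[i]^o.
Proof.
move=> F FF /cauchyP Fc.
(* Real and imaginary parts are additive and 1-Lipschitz, so they carry a Cauchy filter to a Cauchy
   filter of reals. *)
have part (p : R[i] -> R) : (forall x y, p (x - y) = p x - p y) ->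
    (forall z, `|p z| <= normc z) -> cvg (p @ F).
  move=> pB pn; apply: cauchy_cvg; apply: cauchy_exP => e e0.
  have /Fc[z Fz] : 0 < e%:C by rewrite ltcR.
  exists (p z).
  have : F (p @^-1` ball (p z) e); last by [].
  apply: filterS Fz => y /=; rewrite -!ball_normE /= -pB.
  by rewrite normC_normc ltcR; apply: le_lt_trans.
have /cvg_ex[a /cvgrPdist_lt Fa] : cvg (@complex.Re R @ F).
  by apply: part; [case=> ? ? [] | exact: normc_Re_le].
have /cvg_ex[b /cvgrPdist_lt Fb] : cvg (@complex.Im R @ F).
  by apply: part; [case=> ? ? [] | exact: normc_Im_le].
apply/cvg_ex; exists (a +i* b : R[i]^o).
apply/(@cvgrPdist_lt _ R[i]^o) => _ /posC[e e0 ->].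
have e20 : 0 < e / 2 by rewrite divr_gt0.
near=> z; rewrite [X in X < _]normC_normc ltcR; apply: le_lt_trans (normc_le _) _.
rewrite (splitr e) ltrD //.
  have -> : complex.Re ((a +i* b) - z) = a - complex.Re z by case: (z).
  by near: z; apply: Fa.
have -> : complex.Im ((a +i* b) - z) = b - complex.Im z by case: (z).
by near: z; apply: Fb.
Unshelve. all: by end_near. Qed.

Lemma abs_summable (I : choiceType) (f : I -> R[i]^o) (M : R) :
  (forall F : {fset I}, \sum_(i <- F) normc (f i) <= M) -> exists l, has_sum f l.
Proof.
move=> fM; apply: summation_cauchy; [exact: complex_complete|move=> e e0].
have [F0 F0P] := nonneg_tail fM e0; exists F0 => F /F0P Fe.
apply: le_trans (ler_norm_sum _ _ _) _.
by rewrite -[leLHS](rmorph_sum (real_complex R)) lecR.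
Qed.

End completeness.

(** * The Hilbert space l2 *)

Section l2_theory.
Variables (R : realType) (T : choiceType).
Implicit Types x y z : l2 R T.

Lemma sum_le_sqnorm x (F : {fset T}) : \sum_(t <- F) normc (x t) ^+ 2 <= sqnorm x.
Proof.
rewrite -lee_fin sqnormE wsum1; apply: le_esum_fset => t; exact: sqr_ge0.
Qed.

Lemma sqnorm_le x (M : R) :
  (forall F : {fset T}, \sum_(t <- F) normc (x t) ^+ 2 <= M) -> sqnorm x <= M.
Proof. by move=> xM; rewrite -lee_fin sqnormE wsum1; apply: esum_le_fset. Qed.

Lemma l2_normE x : `|x| = (Num.sqrt (sqnorm x))%:C.
Proof. exact: erefl. Qed.

Lemma l2_norm_le x (e : R) : 0 <= e -> (`|x| <= e%:C) = (sqnorm x <= e ^+ 2).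
Proof.
move=> e0; rewrite l2_normE lecR -[in RHS](sqr_sqrtr (sqnorm_ge0 x)).
by rewrite ler_pXn2r // nnegrE sqrtr_ge0.
Qed.

Lemma l2_membership (f : T -> R[i]^o) (M : R) :
  (forall F : {fset T}, \sum_(t <- F) normc (f t) ^+ 2 <= M) -> f \in @l2_set R T.
Proof.
move=> fM; apply/asboolP/esum_ltyP; last by exists M.
by move=> t; exact: sqr_ge0.
Qed.

Lemma normc_coord_le x t : normc (x t) ^+ 2 <= sqnorm x.
Proof. by have := sum_le_sqnorm x [fset t]%fset; rewrite big_seq_fset1. Qed.

Lemma norm_coord_le x t : `|x t : R[i]^o| <= `|x|.
Proof.
rewrite normC_normc l2_normE lecR -(ger0_norm (normc_ge0 (x t))) -sqrtr_sqr.
exact/ler_wsqrtr/normc_coord_le.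
Qed.

Lemma normcD_sqr (a b : R[i]) : normc (a + b) ^+ 2 <= 2 * normc a ^+ 2 + 2 * normc b ^+ 2.
Proof. by have := normcD_young a b ltr01; rewrite invr1 -natr1. Qed.

(** The limit [L] is taken coordinatewise; bounds on finite sets of coordinates, uniform in the set,
    show that it is square summable and a limit in norm. *)
Lemma l2_complete : complete_space (l2 R T).
Proof.
move=> F FF /cauchyP Fc.
have Fbnd (e : R) : 0 < e -> exists x, F [set y | sqnorm (x - y) <= e ^+ 2].
  move=> e0; have /Fc[x Fx] : 0 < e%:C by rewrite ltcR.
  exists x; apply: filterS Fx => y; rewrite -ball_normE /= => /ltW.
  by rewrite l2_norm_le ?(ltW e0).
have coord t : {l : R[i]^o | (fun x : l2 R T => x t : R[i]^o) @ F --> l}.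
  apply/cid/cvg_ex; apply: complex_complete.
  apply: cauchy_exP => _ /posC[e e0 ->].
  have /Fc[x Fx] : 0 < e%:C by rewrite ltcR.
  exists (x t).
  have : F ((fun y : l2 R T => y t : R[i]^o) @^-1` ball (x t : R[i]^o) e%:C); last by [].
  apply: filterS Fx => y /=; rewrite -!ball_normE /=.
  by apply: le_lt_trans; exact: (norm_coord_le (x - y) t).
pose L t := sval (coord t).
(* Compare with a [y] that is [e]-close to [x] and almost equal to [L] on [G]: the inequality (a +
   b)^2 <= 2 a^2 + 2 b^2 gives 2 e^2 + 2 e^2. *)
have LP (e : R) : 0 < e -> forall x, F [set y | sqnorm (x - y) <= e ^+ 2] ->
    forall G : {fset T}, \sum_(t <- G) normc (x t - L t) ^+ 2 <= (2 * e) ^+ 2.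
  move=> e0 x Fx G.
  (* With this [d] the errors d^2 over [G] add up to at most e^2; the successor covers an empty
     [G]. *)
  pose d := e / (#|` G|.+1)%:R.
  have d0 : 0 < d by rewrite divr_gt0.
  have near_L : F (\bigcap_(t in [set` G]) [set y | normc (y t - L t) <= d]).
    apply: filter_bigI => t _; have := svalP (coord t); rewrite -/(L t).
    move/cvgrPdist_le => /(_ d%:C); rewrite ltcR => /(_ d0).
    by apply: filterS => y /=; rewrite distrC normC_normc lecR.
  have [y [/= yx yL]] := filter_ex (filterI Fx near_L).
  apply: le_trans (_ : \sum_(t <- G) (2 * normc ((x - y) t) ^+ 2 + 2 * normc (y t - L t) ^+ 2)
      <= _).
    apply: ler_sum => t _; rewrite (_ : x t - L t = (x - y) t + (y t - L t)) ?normcD_sqr //.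
    by rewrite addrA subrK.
  rewrite big_split -!mulr_sumr /=.
  have := le_trans (sum_le_sqnorm (x - y) G) yx.
  have : \sum_(t <- G) normc (y t - L t) ^+ 2 <= e ^+ 2.
    rewrite big_seq; apply: le_trans (_ : \sum_(t <- G | t \in G) e ^+ 2 / (#|` G|.+1)%:R <= _).
      apply: ler_sum => t tG; have := yL _ tG => /= yd.
      apply: le_trans (_ : d ^+ 2 <= _); first by rewrite ler_pXn2r // nnegrE ?normc_ge0 ?ltW.
      rewrite /d expr_div_n ler_pM2l ?exprn_gt0 // lef_pV2 ?posrE ?exprn_gt0 //.
      by rewrite expr2 ler_peMr // ler1n.
    rewrite -big_seq big_const_seq count_predT iter_addr_0 -[leLHS]mulr_natr -mulrA.
    apply: ler_piMr; rewrite ?sqr_ge0 // mulrC ler_pdivrMr // mul1r ler_nat; exact: leqnSn.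
  rewrite exprMn; lra.
have [x0 Fx0] := Fbnd _ ltr01.
have Lx0 : (fun t => x0 t - L t) \in @l2_set R T.
  by apply: l2_membership; apply: LP Fx0.
(* Only x0 - L is known to be square summable, so L is recovered as a difference. *)
pose x := x0 - L2 Lx0.
have xE t : x t = L t by rewrite /x /= opprB addrC subrK.
apply/cvg_ex; exists x; apply/cvgrPdist_le => _ /posC[e e0 ->].
have e30 : 0 < e / 3 by rewrite divr_gt0.
have [y Fy] := Fbnd _ e30; apply: filterS (Fy) => z yz /=.
have yx : sqnorm (y - x) <= (2 * (e / 3)) ^+ 2.
  apply: sqnorm_le => G; rewrite (eq_bigr (fun t => normc (y t - L t) ^+ 2)).
    exact: LP Fy _.
  by move=> t _; rewrite -xE.
rewrite -(subrKA y) (_ : e = 2 * (e / 3) + e / 3); last by field.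
rewrite rmorphD; apply: le_trans (ler_normD _ _) _.
rewrite distrC lerD // l2_norm_le //; first by rewrite mulr_ge0 // ltW.
by rewrite ltW.
Qed.

(** Absolute convergence, from |a| |b| <= |a|^2 + |b|^2 in each coordinate. *)
Lemma has_sum_inner x y : has_sum (fun t => x t * (y t)^* : R[i]^o) (inner x y).
Proof.
suff [l fl] : exists l, has_sum (fun t => x t * (y t)^* : R[i]^o) l.
  by rewrite /inner (has_sum_sum fl).
apply: (@abs_summable _ _ _ (sqnorm x + sqnorm y)) => F.
apply: le_trans (lerD (sum_le_sqnorm x F) (sum_le_sqnorm y F)).
rewrite -big_split /=; apply: ler_sum => t _.
rewrite normcM (_ : normc (y t)^* = normc (y t)); last first.
  by apply: complexI; rewrite -!normC_normc norm_conjC.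
have := sqr_ge0 (normc (x t) - normc (y t)).
have := mulr_ge0 (normc_ge0 (x t)) (normc_ge0 (y t)).
rewrite sqrrB; lra.
Qed.

Arguments has_sum_inner x y : clear implicits.

Lemma has_sum_innerE x y (l : R[i]) :
  has_sum (fun t => x t * (y t)^* : R[i]^o) (l : R[i]^o) -> l = inner x y.
Proof. by move=> /has_sum_unique; apply; exact: has_sum_inner. Qed.

Lemma inner_linl (a : R[i]) x y z : inner (a *: x + y) z = a * inner x z + inner y z.
Proof.
apply/esym/has_sum_innerE.
have := has_sum_lin (a := a) (has_sum_inner x z) (has_sum_inner y z).
rewrite (_ : (fun t => _) = (fun t => (a *: x + y) t * (z t)^* : R[i]^o)) //.
apply/funext => t; rewrite -[RHS]/((a * x t + y t) * (z t)^*).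
by rewrite mulrDl -mulrA.
Qed.

Lemma has_sum_conj (I : choiceType) (f : I -> R[i]^o) (l : R[i]^o) :
  has_sum f l -> has_sum (fun i => (f i)^* : R[i]^o) (l^* : R[i]^o).
Proof.
move=> /has_sumP fl; apply/has_sumP => e /fl[F0 F0P]; exists F0 => F /F0P.
by rewrite -(rmorph_sum Num.conj) -rmorphB norm_conjC.
Qed.

Lemma innerC x y : inner x y = (inner y x)^*.
Proof.
apply/esym/has_sum_innerE.
have := has_sum_conj (has_sum_inner y x).
by under eq_fun do rewrite rmorphM /= conjCK mulrC.
Qed.

Lemma inner0l z : inner 0 z = 0.
Proof. by have := inner_linl (-1) 0 0 z; rewrite scaler0 add0r mulN1r addNr. Qed.
Lemma inner0r z : inner z 0 = 0. Proof. by rewrite innerC inner0l conjC0. Qed.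
Lemma innerDl x y z : inner (x + y) z = inner x z + inner y z.
Proof. by have := inner_linl 1 x y z; rewrite scale1r mul1r. Qed.
Lemma innerZl a x z : inner (a *: x) z = a * inner x z.
Proof. by have := inner_linl a x 0 z; rewrite !addr0 inner0l addr0. Qed.
Lemma innerBl x y z : inner (x - y) z = inner x z - inner y z.
Proof. by rewrite innerDl -scaleN1r innerZl mulN1r. Qed.
Lemma innerDr x y z : inner z (x + y) = inner z x + inner z y.
Proof. by rewrite innerC innerDl rmorphD /= -!(innerC z). Qed.
Lemma innerZr a x z : inner z (a *: x) = a^* * inner z x.
Proof. by rewrite innerC innerZl rmorphM /= -(innerC z). Qed.
Lemma innerBr x y z : inner z (x - y) = inner z x - inner z y.
Proof. by rewrite innerC innerBl rmorphB /= -!(innerC z). Qed.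
Lemma inner_suml (I : Type) (s : seq I) (f : I -> l2 R T) z :
  inner (\sum_(i <- s) f i) z = \sum_(i <- s) inner (f i) z.
Proof. by elim/big_rec2: _ => [|i a b _ <-]; rewrite ?inner0l // innerDl. Qed.
Lemma inner_sumr (I : Type) (s : seq I) (f : I -> l2 R T) z :
  inner z (\sum_(i <- s) f i) = \sum_(i <- s) inner z (f i).
Proof. by elim/big_rec2: _ => [|i a b _ <-]; rewrite ?inner0r // innerDr. Qed.

Lemma inner_self x : inner x x = (sqnorm x)%:C.
Proof.
apply/esym/has_sum_innerE.
apply/has_sumP => e e0.
have [F0 F0P] := nonneg_tail (sum_le_sqnorm x) e0; exists F0 => F sF.
have cE t : x t * (x t)^* = (normc (x t) ^+ 2)%:C.
  by rewrite -normCK normC_normc -rmorphXn.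
under eq_bigr do rewrite cE.
rewrite -[X in _ - X](rmorph_sum (real_complex R)) -rmorphB /= ger0_norm; last first.
  by rewrite ler0c subr_ge0 sum_le_sqnorm.
rewrite lecR lerBlDr; apply: sqnorm_le => G.
apply: le_trans (_ : \sum_(t <- (F `|` G)%fset) normc (x t) ^+ 2 <= _).
  by rewrite (sum_fsetD _ (fsubsetUr F G)) lerDl sumr_ge0 // => t _; exact: sqr_ge0.
rewrite (sum_fsetD _ (fsubsetUl F G)) addrC lerD2r F0P //.
apply/fdisjointP => t; rewrite !inE => /andP[tF _].
by apply: contra tF; apply: (fsubsetP sF).
Qed.

Lemma inner_eq0 x : inner x x = 0 -> x = 0.
Proof.
rewrite inner_self => -[x0]; apply: l2norm_eq0.
by rewrite /l2norm x0 sqrtr0.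
Qed.

(** A crude stand-in for Cauchy-Schwarz: continuity of a functional only requires some bound on the
    unit ball. *)
Lemma norm_inner_le x y : normc (inner x y) <= sqnorm x + sqnorm y.
Proof.
rewrite -lecR -normC_normc; apply: (has_sum_le (has_sum_inner x y)) => F.
apply: le_trans (ler_norm_sum _ _ _) _; rewrite rmorphD /=.
apply: le_trans (_ : (\sum_(t <- F) (normc (x t) ^+ 2 + normc (y t) ^+ 2))%:C <= _).
  rewrite [leRHS]rmorph_sum; apply: ler_sum => t _.
  rewrite normrM norm_conjC !normC_normc -rmorphM lecR.
  have := sqr_ge0 (normc (x t) - normc (y t)).
  have := mulr_ge0 (normc_ge0 (x t)) (normc_ge0 (y t)).
  rewrite sqrrB; lra.
rewrite big_split /= rmorphD lerD // lecR; exact: sum_le_sqnorm.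
Qed.

End l2_theory.

(** * Orthogonal expansions *)

Section orthogonal_expansion.
Variables (R : realType) (T K : choiceType) (e : K -> l2 R T) (w : K -> R).
Hypothesis w_gt0 : forall k, 0 < w k.
Hypothesis e_self : forall k, inner (e k) (e k) = (w k)%:C.
Hypothesis e_orth : forall j k, j != k -> inner (e j) (e k) = 0.

(** The [e k] are orthogonal but not normalized; dividing by [w k] gives the coefficient of [e k]
    itself. *)
Definition fourier (x : l2 R T) (k : K) : R[i] := inner x (e k) / (w k)%:C.

Let wC_neq0 k : (w k)%:C != 0.
Proof. by rewrite (inj_eq (@complexI R)) gt_eqF. Qed.

Lemma inner_partial (c : K -> R[i]) (F : {fset K}) k :
  inner (\sum_(j <- F) c j *: e j) (e k) = if k \in F then c k * (w k)%:C else 0.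
Proof.
rewrite inner_suml; case: ifPn => kF.
  rewrite (big_fsetD1 k) //= innerZl e_self big1_seq ?addr0 // => j.
  by rewrite !inE /= => /andP[jk _]; rewrite innerZl e_orth ?mulr0.
rewrite big1_seq // => j /= jF; rewrite innerZl e_orth ?mulr0 //.
by apply: contraNneq kF => <-.
Qed.

Lemma sqnorm_add (x y : l2 R T) : inner x y = 0 -> sqnorm (x + y) = sqnorm x + sqnorm y.
Proof.
move=> xy0; apply: complexI; rewrite rmorphD /= -!inner_self innerDl !innerDr xy0.
by rewrite (innerC y x) xy0 conjC0 addr0 add0r.
Qed.

Lemma sqnorm_partial (c : K -> R[i]) (F : {fset K}) :
  sqnorm (\sum_(j <- F) c j *: e j) = \sum_(j <- F) normc (c j) ^+ 2 * w j.
Proof.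
apply: complexI; rewrite -inner_self inner_sumr [RHS]rmorph_sum /=.
apply: eq_big_seq => k kF; rewrite innerZr inner_partial kF mulrA.
by rewrite [_^* * _]mulrC -normCK normC_normc -rmorphXn -rmorphM.
Qed.

Lemma inner_remainder x (F : {fset K}) (c : K -> R[i]) :
  inner (x - \sum_(j <- F) fourier x j *: e j) (\sum_(j <- F) c j *: e j) = 0.
Proof.
rewrite inner_sumr big1_seq // => k /= kF.
by rewrite innerZr innerBl inner_partial kF divfK // subrr mulr0.
Qed.

Lemma bessel x (F : {fset K}) : \sum_(j <- F) normc (fourier x j) ^+ 2 * w j <= sqnorm x.
Proof.
rewrite -sqnorm_partial -{2}[x](subrK (\sum_(j <- F) fourier x j *: e j)).
by rewrite sqnorm_add ?inner_remainder // lerDr sqnorm_ge0.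
Qed.

(** The Fourier remainder is orthogonal to the span of the [e j] with [j] in [F], so Pythagoras
    applies. *)
Lemma sqnorm_best x (F : {fset K}) (c : K -> R[i]) :
  sqnorm (x - \sum_(j <- F) fourier x j *: e j) <= sqnorm (x - \sum_(j <- F) c j *: e j).
Proof.
rewrite -[x in leRHS](subrK (\sum_(j <- F) fourier x j *: e j)) -addrA -sumrB.
have -> : \sum_(j <- F) (fourier x j *: e j - c j *: e j) =
    \sum_(j <- F) (fourier x j - c j) *: e j.
  by apply: eq_bigr => j _; rewrite scalerBl.
by rewrite [leRHS]sqnorm_add ?inner_remainder // lerDl sqnorm_ge0.
Qed.

(** The list may repeat indices, hence the regrouping. Having the representation on every larger [G]
    lets one approximant be compared with all late Fourier sums. *)
Lemma lin_span_partial x : lin_span e x ->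
  exists (F : {fset K}), forall G : {fset K}, (F `<=` G)%fset ->
    exists c : K -> R[i], x = \sum_(k <- G) c k *: e k.
Proof.
case=> s ->; exists [fset k | k in [seq p.2 | p <- s]]%fset => G sG.
have {sG} : {subset [seq p.2 | p <- s] <= G}.
  by move=> k ks; apply: (fsubsetP sG); rewrite !inE.
elim: s => [|[a k] s IH] sG.
  by exists (fun=> 0); rewrite big_nil big1 // => i _; rewrite scale0r.
have [|c cE] := IH; first by move=> j js; apply: sG; rewrite inE js orbT.
exists (fun j => (j == k)%:R * a + c j); rewrite big_cons cE /=.
under [RHS]eq_bigr do rewrite scalerDl.
rewrite big_split /=; congr (_ + _).
have kG : k \in G by apply: sG; rewrite inE eqxx.
rewrite (big_fsetD1 k) //= eqxx mul1r big1_seq ?addr0 // => j.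
by rewrite !inE /= => /andP[/negbTE -> _]; rewrite mul0r scale0r.
Qed.

Lemma has_sum_fourier x : closure (lin_span e) x ->
  has_sum (fun k => fourier x k *: e k) x.
Proof.
move=> xcl; apply/has_sumP => d d0.
have dC : 0 < d%:C by rewrite ltcR.
have [v [/lin_span_partial[F0 F0P] xv]] := xcl _ (nbhsx_ballx x _ dC).
exists F0 => F /F0P[c vE]; move: xv; rewrite -ball_normE /= vE => /ltW.
rewrite !l2_norm_le ?(ltW d0) //; apply: le_trans; exact: sqnorm_best.
Qed.

(** By Pythagoras small tails of the weighted series are small norms, and completeness supplies the
    sum. *)
Lemma riesz_fischer (c : K -> R[i]) (M : R) :
  (forall F : {fset K}, \sum_(k <- F) normc (c k) ^+ 2 * w k <= M) ->
  exists2 x, closure (lin_span e) x & has_sum (fun k => c k *: e k) x.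
Proof.
move=> cM; have [|x fx] := summation_cauchy (@l2_complete R T) (f := fun k => c k *: e k).
  move=> d d0; have d20 : 0 < d ^+ 2 by rewrite exprn_gt0.
  have [F0 F0P] := nonneg_tail cM d20; exists F0 => F /F0P.
  by rewrite l2_norm_le ?(ltW d0) // sqnorm_partial.
exists x => // B /nbhs_ballP[_ /posC[d d0 ->] dB].
have d20 : 0 < d / 2 by rewrite divr_gt0.
move/has_sumP : fx => /(_ _ d20)[F0 /(_ F0 (fsubset_refl _)) F0P].
exists (\sum_(k <- F0) c k *: e k); split.
  by exists [seq (c k, k) | k <- F0]; rewrite big_map.
apply: dB; rewrite -ball_normE /=; apply: le_lt_trans F0P _; rewrite ltcR; lra.
Qed.

End orthogonal_expansion.

(** The radius is left free because Baire's argument yields a bound on a ball of unknown size. *)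
Lemma bounded_unit_continuous (R : realType) (V W : normedModType R[i]) (L : V -> W)
    (r C : R) : linear L -> 0 < r ->
  (forall x, `|x| <= r%:C -> `|L x| <= C%:C) -> continuous L.
Proof.
move=> Llin r0 LC; pose L' : {linear V -> W} :=
  HB.pack L (GRing.isLinear.Build _ _ _ _ _ Llin).
apply: (@bounded_linear_continuous _ _ _ L').
exists C%:C; split; first by apply/complex_realP; exists C.
move=> M CM; apply/nbhs_ballP; exists r%:C; first by rewrite /= ltcR.
move=> x; rewrite -ball_normE /= sub0r normrN => /ltW /LC xC.
exact: le_trans xC (ltW CM).
Qed.

Section inner_continuity.
Variables (R : realType) (T : choiceType).

Lemma inner_continuous (y : l2 R T) : continuous (fun x : l2 R T => inner x y : R[i]^o).
Proof.
apply: (@bounded_unit_continuous _ _ _ _ 1 (1 + sqnorm y)) => //.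
  by move=> a x z; exact: inner_linl.
move=> x; rewrite l2_norm_le // expr1n => x1; rewrite normC_normc lecR.
by apply: le_trans (norm_inner_le _ _) _; rewrite lerD2r.
Qed.

Lemma has_sum_innerl (K : choiceType) (f : K -> l2 R T) x y :
  has_sum f x -> has_sum (fun k => inner (f k) y : R[i]^o) (inner x y : R[i]^o).
Proof.
move=> fx; apply: (has_sum_map _ (@inner_continuous y) fx).
by move=> a u v; exact: inner_linl.
Qed.

Lemma has_sum_innerr (K : choiceType) (f : K -> l2 R T) x y :
  has_sum f x -> has_sum (fun k => inner y (f k) : R[i]^o) (inner y x : R[i]^o).
Proof.
move=> fx; have := has_sum_conj (has_sum_innerl (y := y) fx).
by rewrite -innerC; under eq_fun do rewrite -innerC.
Qed.

End inner_continuity.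

(** * The symmetric Fock space *)

Section word_classes.
Variables (R : realType) (n : nat).
Implicit Types (a b : word n) (k : multi_index n) (l : 'rV[R[i]^o]_n).

Definition word_class a : multi_index n := [ffun i => count_mem i a].

Lemma word_class_cons i a : word_class (i :: a) = word_class [:: i] + word_class a.
Proof. by apply/ffunP => j; rewrite !ffunE /= addn0. Qed.

Lemma monomialD l k p : monomial l (k + p) = monomial l k * monomial l p.
Proof.
by rewrite /monomial -big_split /=; apply: eq_bigr => i _; rewrite !ffunE exprD.
Qed.

Lemma monomial1 l i : monomial l (word_class [:: i]) = l ord0 i.
Proof.
rewrite /monomial (bigD1 i) //= big1 ?mulr1 ?ffunE /= ?eqxx ?expr1 // => j ji.
by rewrite ffunE /= eq_sym (negbTE ji) expr0.
Qed.

Lemma word_evalE l a : word_eval l a = monomial l (word_class a).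
Proof.
rewrite /word_eval; elim: a => [|i a IH].
  by rewrite big_nil /monomial big1 // => i _; rewrite ffunE expr0.
by rewrite big_cons IH word_class_cons monomialD monomial1.
Qed.

Lemma abelianization_classE k a : abelianization_class R k a <-> word_class a = k.
Proof.
split=> [ka|<- l]; last exact: word_evalE.
(* At this test point a monomial equals 2 to its [i]-th exponent. *)
apply/ffunP => i; pose l : 'rV[R[i]^o]_n := \row_j (if j == i then 2 else 1).
have lE p : monomial l p = 2 ^+ p i.
  rewrite /monomial (bigD1 i) //= big1 ?mulr1 ?mxE ?eqxx // => j /negbTE ji.
  by rewrite mxE ji expr1n.
have := ka l; rewrite word_evalE !lE -!natrX => /eqP.
by rewrite eqr_nat eqn_exp2l // => /eqP.
Qed.

(** No class is empty: this makes [omega k] positive, and every y^(k) a product of shifts applied to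
    the vacuum. *)
Lemma word_class_surj k : exists a, word_class a = k.
Proof.
exists (flatten [seq nseq (k i) i | i <- enum 'I_n]); apply/ffunP => i.
rewrite ffunE count_flatten sumnE -map_comp big_map big_enum /= (bigD1 i) //=.
rewrite big1 => [|j /negbTE ji]; rewrite count_nseq /= ?ji // eqxx mul1n.
exact: addr0.
Qed.

End word_classes.

Section fock.
Variables (R : realType) (n : nat) (mu : weight R n).
Local Notation word := (word n).
Local Notation multi_index := (multi_index n).
Local Notation Fock := (l2 R word).
Local Notation bmu := (weight_prod mu).
Local Notation omega := (class_weight mu).
Local Notation Y := (class_vector mu).
Implicit Types (a b : word) (k : multi_index) (x y : Fock).

Definition class_words k : {fset word} := fset_set (abelianization_class R k).

Lemma mem_class_words k a : (a \in class_words k) = (word_class a == k).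
Proof.
rewrite in_fset_set; last exact: finite_Lambda.
by apply/idP/eqP => [|ka]; rewrite inE; [move/abelianization_classE|apply/abelianization_classE].
Qed.

Lemma class_weightE k : omega k = \sum_(a <- class_words k) (bmu a ^+ 2)^-1.
Proof. by rewrite /class_weight fsbig_finite //; exact: finite_Lambda. Qed.

Lemma class_weight_gt0 k : 0 < omega k.
Proof.
have [a ak] := word_class_surj k; rewrite class_weightE.
have ain : a \in class_words k by rewrite mem_class_words ak.
rewrite (big_fsetD1 a) //= ltr_pwDl ?invr_gt0 ?exprn_gt0 ?weight_prod_gt0 //.
by apply: sumr_ge0 => b _; rewrite invr_ge0 sqr_ge0.
Qed.

Lemma l2_sumE (T : choiceType) (I : Type) (s : seq I) (f : I -> l2 R T) t :
  (\sum_(i <- s) f i) t = \sum_(i <- s) f i t.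
Proof. by elim/big_rec2: _ => // i y1 y2 _ <-. Qed.

Lemma l2_scaleE (T : choiceType) (c : R[i]) (f : l2 R T) t : (c *: f) t = c * f t.
Proof. exact: erefl. Qed.

Lemma inner_fock_basis x a : inner x (fock_basis R a) = x a.
Proof.
have := @has_sum_single _ _ R[i]^o (fun t => x t * (fock_basis R a t)^*) a.
rewrite /= eqxx conjC1 mulr1 => xa; apply/esym/has_sum_innerE/xa => b.
by move=> /negbTE ->; rewrite conjC0 mulr0.
Qed.

Lemma inner_class_vector x k :
  inner x (Y k) = ((omega k)^-1)%:C * \sum_(a <- class_words k) x a * ((bmu a)^-1)%:C.
Proof.
have conjR (r : R) : (r%:C)^* = r%:C by exact: conjc_real.
rewrite /class_vector fsbig_finite; last exact: finite_Lambda.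
rewrite innerZr conjR inner_sumr; congr (_ * _); apply: eq_bigr => a _.
by rewrite innerZr conjR inner_fock_basis mulrC.
Qed.

Lemma class_vectorE k a :
  Y k a = if word_class a == k then ((omega k)^-1 / bmu a)%:C else 0.
Proof.
rewrite /class_vector fsbig_finite; last exact: finite_Lambda.
rewrite l2_scaleE l2_sumE -mem_class_words.
under eq_bigr do rewrite l2_scaleE /=.
case: ifPn => ka.
  rewrite (big_fsetD1 a) //= big1_seq => [|b].
    by rewrite addr0 eqxx mulr1 -rmorphM.
  rewrite !inE /= => /andP[ba _]; rewrite eq_sym.
  by rewrite (negbTE ba) mulr0.
rewrite big1_seq ?mulr0 // => b /= bk.
by rewrite (negbTE (_ : a != b)) ?mulr0 //; apply: contraNneq ka => ->.
Qed.

Lemma class_vector_self k : inner (Y k) (Y k) = ((omega k)^-1)%:C.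
Proof.
rewrite inner_class_vector (_ : \sum_(a <- _) _ = 1) ?mulr1 //.
have -> : 1 = ((omega k)^-1 * omega k)%:C by rewrite mulVf ?gt_eqF ?class_weight_gt0.
rewrite {2}class_weightE mulr_sumr [RHS]rmorph_sum; apply: eq_big_seq => a.
rewrite mem_class_words class_vectorE => -> /=.
by rewrite -rmorphM -mulrA -invfM.
Qed.

Lemma class_vector_orth j k : j != k -> inner (Y j) (Y k) = 0.
Proof.
move=> jk; rewrite inner_class_vector big1_seq ?mulr0 // => a /andP[_].
rewrite mem_class_words class_vectorE => /eqP ->.
by rewrite eq_sym (negbTE jk) mul0r.
Qed.

Let w_gt0 k : 0 < (omega k)^-1. Proof. by rewrite invr_gt0 class_weight_gt0. Qed.

(** Defined on the whole Fock space: outside the symmetric subspace these are the coefficients of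
    the projection. *)
Definition sym_coef x k : R[i] := fourier Y (fun k => (omega k)^-1) x k.

Lemma sym_coefE x k : sym_coef x k = \sum_(a <- class_words k) x a * ((bmu a)^-1)%:C.
Proof.
rewrite /sym_coef /fourier inner_class_vector mulrAC divff ?mul1r //.
by rewrite (inj_eq (@complexI R)) gt_eqF.
Qed.

Lemma inner_sym_coef x k : inner x (Y k) = sym_coef x k / (omega k)%:C.
Proof.
rewrite /sym_coef /fourier fmorphV invrK mulfK //.
by rewrite (inj_eq (@complexI R)) gt_eqF ?class_weight_gt0.
Qed.

Lemma sym_bessel x (F : {fset multi_index}) :
  \sum_(k <- F) normc (sym_coef x k) ^+ 2 / omega k <= sqnorm x.
Proof. exact: bessel w_gt0 class_vector_self class_vector_orth _ _. Qed.

Lemma class_expansion_val (c : multi_index -> R[i]) x a :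
  has_sum (fun k => c k *: Y k) x ->
  x a = c (word_class a) * ((omega (word_class a))^-1 / bmu a)%:C.
Proof.
move=> /(has_sum_innerl (y := fock_basis R a)); rewrite inner_fock_basis => cx.
apply: has_sum_unique cx _.
have := @has_sum_single _ _ R[i]^o (fun k => inner (c k *: Y k) (fock_basis R a)) (word_class a).
rewrite innerZl inner_fock_basis class_vectorE eqxx; apply=> k.
rewrite innerZl inner_fock_basis class_vectorE eq_sym => /negbTE ->.
by rewrite mulr0.
Qed.

Lemma class_expansion_coef (c : multi_index -> R[i]) x k :
  has_sum (fun k => c k *: Y k) x -> sym_coef x k = c k.
Proof.
move=> cx; rewrite sym_coefE.
have -> : c k = c k * ((omega k)^-1 * omega k)%:C.
  by rewrite mulVf ?gt_eqF ?class_weight_gt0 // mulr1.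
rewrite {2}class_weightE mulr_sumr rmorph_sum mulr_sumr; apply: eq_big_seq => a.
rewrite mem_class_words (class_expansion_val _ cx) => /eqP ->.
by rewrite -mulrA -!rmorphM /= -mulrA -invfM.
Qed.

Lemma class_expansion_exists (c : multi_index -> R[i]) (M : R) :
  (forall F : {fset multi_index}, \sum_(k <- F) normc (c k) ^+ 2 / omega k <= M) ->
  exists2 x, x \in symFock_set mu & has_sum (fun k => c k *: Y k) x.
Proof.
move=> /(riesz_fischer class_vector_self class_vector_orth)[x xcl cx].
by exists x => //; apply/asboolP.
Qed.

Lemma sym_expand x : x \in symFock_set mu -> has_sum (fun k => sym_coef x k *: Y k) x.
Proof. by move=> /asboolP /(has_sum_fourier w_gt0 class_vector_self class_vector_orth). Qed.

(** Replaces membership in a closed span by an equation between coordinates, which is immediate to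
    check for the kernels and for W_i^* x. *)
Lemma symFockE x : x \in symFock_set mu <->
  forall a b, word_class a = word_class b -> x a * (bmu a)%:C = x b * (bmu b)%:C.
Proof.
have bC a : (bmu a)%:C != 0 by rewrite (inj_eq (@complexI R)) gt_eqF ?weight_prod_gt0.
split=> [/sym_expand xs a b ab|xs].
  rewrite !(class_expansion_val _ xs) ab -!mulrA -!rmorphM /=.
  by rewrite !divfK // gt_eqF ?weight_prod_gt0.
(* [x'] is the projection of [x]; since [x a * bmu a] is constant on classes, the sum defining
   [sym_coef] collapses and [x'] has the coordinates of [x]. *)
have [x' x's cx] := class_expansion_exists (sym_bessel x).
suff -> : x = x' by [].
apply: val_inj; apply/funext => a; rewrite [RHS](class_expansion_val _ cx).
have -> : sym_coef x (word_class a) = x a * (bmu a)%:C * (omega (word_class a))%:C.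
  rewrite sym_coefE class_weightE rmorph_sum mulr_sumr; apply: eq_big_seq => b.
  rewrite mem_class_words => /eqP /xs <-.
  by rewrite -mulrA -rmorphM expr2 invfM mulrA mulfV ?mul1r // gt_eqF ?weight_prod_gt0.
rewrite -!mulrA -!rmorphM /= -[LHS]mulr1; congr (_ * _%:C).
by field; rewrite !gt_eqF ?weight_prod_gt0 ?class_weight_gt0.
Qed.

Lemma sym_proj_exists x : exists y : symFock mu, forall z : symFock mu, inner (x - y) z = 0.
Proof.
have [y ys cy] := class_expansion_exists (sym_bessel x).
exists (SymFock ys) => z; have /(has_sum_innerr (y := x - y)) zs := sym_expand (symFockP z).
apply: has_sum_unique zs _.
rewrite (_ : (fun k => _) = fun=> 0); last first.
  apply/funext => k; rewrite innerZr innerBl !inner_sym_coef.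
  by rewrite (class_expansion_coef k cy) subrr mulr0.
by have := @has_sum_fin _ _ R[i]^o (fun=> 0) (@fset0 multi_index); rewrite big_nil; apply.
Qed.

Lemma sym_projP x (z : symFock mu) : inner (sym_proj mu x) z = inner x z.
Proof.
have : [set y : symFock mu | forall z : symFock mu, inner (x - y) z = 0] (sym_proj mu x).
  by rewrite /sym_proj; apply: xgetPex; exact: sym_proj_exists.
by move=> /(_ z) /eqP; rewrite innerBl subr_eq0 => /eqP.
Qed.

Lemma adjoint_left_shift_subproof i x :
  (fun a => (mu (i :: a))%:C * x (i :: a) : R[i]^o) \in @l2_set R word.
Proof.
have [M Mub] := weight_cons_bounded mu i.
apply: (@l2_membership _ _ _ (M ^+ 2 * sqnorm x)) => F.
apply: le_trans (_ : M ^+ 2 * (\sum_(a <- [fset i :: b | b in F]%fset) normc (x a) ^+ 2) <= _).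
  rewrite big_imfset /= => [|? ? _ _ []] //.
  rewrite mulr_sumr; apply: ler_sum => a _; rewrite normcM exprMn ler_wpM2r ?sqr_ge0 //.
  have m0 : 0 <= mu (i :: a) by rewrite ltW // weight_gt0.
  have mM : mu (i :: a) <= M by apply: Mub; exists a.
  by rewrite normc_sqr /= expr0n addr0 lerXn2r // nnegrE (le_trans m0).
by rewrite ler_wpM2l ?sqr_ge0 // sum_le_sqnorm.
Qed.
(** W_i^* in coordinates; [adjoint_left_shiftE] identifies it with the chosen vector of
    [adjoint]. *)
Definition adjoint_left_shift i x : Fock := L2 (adjoint_left_shift_subproof i x).

Lemma inner_left_shift i x y :
  inner (left_shift mu i x) y = inner x (adjoint_left_shift i y).
Proof.
apply: has_sum_innerE.
have := @has_sum_inner _ _ (left_shift mu i x) y.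
rewrite (@has_sum_reindex _ _ _ _ (cons i)); last 2 first.
- by move=> ? ? [].
- move=> [|j a] ni /=; first by rewrite mul0r.
  by case: eqP ni => [->|_ _]; rewrite ?mul0r // => -[]; exists a.
congr (has_sum _ _); apply/funext => a /=; rewrite eqxx.
by rewrite rmorphM /= [(_%:C)^*]conjc_real mulrCA mulrA.
Qed.

(** Since bmu(i a) = mu(i a) bmu(a), the class invariant of W_i^* x at [a] is that of [x] at
    [i :: a]. *)
Lemma adjoint_left_shift_sym i x : x \in symFock_set mu ->
  adjoint_left_shift i x \in symFock_set mu.
Proof.
move=> /symFockE xs; apply/symFockE => a b ab /=.
rewrite ![_%:C * x _]mulrC -!mulrA -!rmorphM.
by apply: (xs (i :: a) (i :: b)); rewrite word_class_cons ab -word_class_cons.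
Qed.

Lemma eigen_kernel_sym (l : weight_domain mu) : eigen_kernel l \in symFock_set mu.
Proof.
apply/symFockE => a b ab /=.
by rewrite !divfK ?(inj_eq (@complexI R)) ?gt_eqF ?weight_prod_gt0 // !word_evalE ab.
Qed.

End fock.

(** * Order of vanishing of power series *)

Lemma digits_lt (N n : nat) (f : 'I_n -> nat) : (forall i, f i < N)%N ->
  (\sum_(i < n) f i * N ^ i < N ^ n)%N.
Proof.
elim: n f => [|n IH] f fN; first by rewrite big_ord0 expn0.
rewrite big_ord_recr /= expnS; apply: leq_trans (_ : (f ord_max).+1 * N ^ n <= _)%N.
  by rewrite mulSn ltn_add2r; apply: (IH (fun i => f (widen_ord _ i))).
by rewrite leq_mul2r fN orbT.
Qed.

(** Uniqueness of base-[N] digits: division by [N ^ n] reads off the leading one. *)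
Lemma digits_inj (N n : nat) (f g : 'I_n -> nat) :
  (forall i, f i < N)%N -> (forall i, g i < N)%N ->
  (\sum_(i < n) f i * N ^ i = \sum_(i < n) g i * N ^ i)%N -> f =1 g.
Proof.
elim: n f g => [|n IH] f g fN gN; first by move=> _ [].
rewrite !big_ord_recr /= => fg.
have N0 : (0 < N ^ n)%N by rewrite expn_gt0 (leq_trans _ (fN ord_max)).
have small (h : 'I_n.+1 -> nat) : (forall i, h i < N)%N ->
    (\sum_(i < n) h (widen_ord (leqnSn n) i) * N ^ i < N ^ n)%N.
  by move=> hN; apply: digits_lt => i.
have top : f ord_max = g ord_max.
  have := congr1 (fun m => m %/ N ^ n)%N fg.
  by rewrite /= ![(_ + _ * _)%N]addnC !divnMDl // !divn_small ?addn0 ?small.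
move: fg; rewrite top => /addIn /IH fg i.
have [->//|ni] := eqVneq i ord_max.
have ilt : (i < n)%N.
  by move: (ltn_ord i); rewrite ltnS leq_eqVlt => /orP[/eqP ie|//]; case/eqP: ni; exact: val_inj.
have -> : i = widen_ord (leqnSn n) (Ordinal ilt) by exact: val_inj.
by apply: fg => j.
Qed.

Section power_series.
Variables (R : realType) (n : nat).
Implicit Types (k q : multi_index n) (l : 'rV[R[i]^o]_n).

Definition degree k : nat := (\sum_i k i)%N.

Lemma normc_monomial_le l k (s : R) : (forall i, normc (l ord0 i) <= s) ->
  normc (monomial l k) <= s ^+ degree k.
Proof.
move=> ls; rewrite -lecR -normC_normc /monomial normr_prod rmorphXn /degree.
rewrite (big_morph (fun m => (s%:C : R[i]) ^+ m) (exprD _) (expr0 _)).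
apply: ler_prod => i _; rewrite normr_ge0 normrX lerXn2r ?nnegrE //.
  by rewrite ler0c; apply: le_trans (ls i); exact: normc_ge0.
by rewrite normC_normc lecR.
Qed.

(* Kronecker's substitution: along the curve [l_j = t ^ (L + N ^ j)] distinct monomials
   of degree at most [d] have distinct orders in [t], all smaller than [L * d.+1]. *)
Lemma power_series_order (c : multi_index n -> R[i]) (r M C : R) (d : nat) :
  0 < r <= 1 -> 0 <= C ->
  (forall F : {fset multi_index n}, \sum_(k <- F) normc (c k) * r ^+ degree k <= M) ->
  (forall l s, 0 < s <= r -> (forall i, normc (l ord0 i) <= s) ->
    exists2 h : R[i]^o, has_sum (fun k => c k * monomial l k : R[i]^o) h &
      normc h <= C * s ^+ d.+1) ->
  forall k, (degree k <= d)%N -> c k = 0.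
Proof.
move=> /andP[r0 r1] C0 cM hP k0 k0d; apply/eqP/negPn/negP => ck0.
(* In degree at most [d] the exponents are base-[N] digits, and [L] exceeds the number they form:
   dividing [key] by [L] leaves the degree as quotient and the digits as remainder. *)
pose N := d.+1; pose L := (N ^ n)%N.
pose key k := (\sum_j k j * (L + N ^ j))%N.
have L0 : (0 < L)%N by rewrite expn_gt0.
have keyE k : key k = (degree k * L + \sum_j k j * N ^ j)%N.
  by rewrite /key /degree big_distrl -big_split; apply: eq_bigr => j _; rewrite mulnDr.
have deg_lt k : (degree k <= d)%N -> forall j, (k j < N)%N.
  by move=> kd j; rewrite ltnS (leq_trans _ kd) // /degree (bigD1 j) //= leq_addr.
have key_lt k : (degree k <= d)%N -> (key k < L * N)%N.
  move=> kd; rewrite keyE; apply: leq_trans (_ : (degree k).+1 * L <= _)%N.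
    by rewrite mulSn addnC ltn_add2r digits_lt // => j; exact: deg_lt.
  by rewrite mulnC leq_mul2l ltnS kd orbT.
have deg_le k : (key k < L * N)%N -> (degree k <= d)%N.
  rewrite keyE => kN; rewrite -ltnS -(ltn_pmul2r L0).
  by apply: leq_ltn_trans (leq_addr _ _) _; rewrite (mulnC d.+1); exact: kN.
have key_inj k q : (degree k <= d)%N -> key k = key q -> k = q.
  move=> kd kq; have qd : (degree q <= d)%N by apply: deg_le; rewrite -kq key_lt.
  have kN := deg_lt _ kd; have qN := deg_lt _ qd.
  move: (kq); rewrite !keyE => E.
  have E1 : (degree k = degree q)%N.
    have := congr1 (fun m => m %/ L)%N E.
    by rewrite /= !divnMDl // !divn_small ?addn0 //; exact: digits_lt.
  by apply/ffunP; apply: digits_inj kN qN _; move: E; rewrite E1 => /addnI.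
(* The term of least order along the curve; comparison with [k0] puts its key below [L * N]. *)
have [q cq qmin] : exists2 q, c q != 0 & forall k, c k != 0 -> (key q <= key k)%N.
  pose P m := `[< exists2 k, c k != 0 & key k = m >].
  have exP : exists m, P m by exists (key k0); apply/asboolP; exists k0.
  case: (ex_minnP exP) => m /asboolP[q cq <-] qm; exists q => // k ck.
  by apply: qm; apply/asboolP; exists k.
have qN : (key q < L * N)%N by apply: leq_ltn_trans (qmin _ ck0) (key_lt _ k0d).
have qd := deg_le _ qN.
have qlt k : k != q -> c k != 0 -> (key q < key k)%N.
  move=> kq ck; rewrite ltn_neqAle qmin // andbT.
  by apply: contra kq => /eqP /(key_inj _ _ qd) ->.
pose m := (key q).+1.
(* The whole sum and all terms but the [q]-th are of order t^m, while the [q]-th has order m - 1: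
   cancelling leaves one factor [t]. *)
have est t : 0 < t <= r -> normc (c q) <= (C + M / r ^+ m) * t.
  move=> /andP[t0 tr]; have t1 : t <= 1 by exact: le_trans tr r1.
  pose l : 'rV[R[i]^o]_n := \row_j (t ^+ (L + N ^ j))%:C.
  have normc_t p : normc (t ^+ p)%:C = t ^+ p.
    apply: complexI; rewrite -normC_normc ger0_norm // ler0c exprn_ge0 // ltW //.
  have lE k : monomial l k = (t ^+ key k)%:C.
    rewrite /key (big_morph (fun p => t ^+ p) (exprD _) (expr0 _)) rmorph_prod.
    by apply: eq_bigr => j _; rewrite mxE -rmorphXn -exprM [in LHS]mulnC.
  have tL : 0 < t ^+ L <= r.
    rewrite exprn_gt0 //= (le_trans _ tr) // -(prednK L0) exprS.
    by rewrite ler_piMr ?(ltW t0) // exprn_ile1 ?(ltW t0).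
  have ls j : normc (l ord0 j) <= t ^+ L.
    by rewrite mxE normc_t ler_wiXn2l ?(ltW t0) // leq_addr.
  have [h hsum hle] := hP l _ tL ls.
  (* The bound at s = t^L is C t^(L N), and m <= L N. *)
  have hle' : normc h <= C * t ^+ m.
    apply: le_trans hle _; rewrite ler_wpM2l // -exprM ler_wiXn2l ?(ltW t0) //.
  have rest : normc (h - c q * (t ^+ key q)%:C) <= M / r ^+ m * t ^+ m.
    pose g k : R[i]^o := if k == q then - (c q * (t ^+ key q)%:C) else 0.
    have gsum : has_sum g (- (c q * (t ^+ key q)%:C) : R[i]^o).
      have <- : g q = - (c q * (t ^+ key q)%:C) by rewrite /g eqxx.
      by apply: has_sum_single => k; rewrite /g => /negbTE ->.
    have := has_sum_lin (a := 1) hsum gsum; rewrite scale1r => hg.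
    rewrite -lecR -normC_normc; apply: (has_sum_le hg) => F.
    apply: le_trans (ler_norm_sum _ _ _) _.
    apply: le_trans (_ : (\sum_(k <- F) normc (c k) * r ^+ degree k / r ^+ m * t ^+ m)%:C <= _).
      rewrite [leRHS]rmorph_sum; apply: ler_sum => k _; rewrite normC_normc lecR scale1r lE /g.
      have rhs0 : 0 <= normc (c k) * r ^+ degree k / r ^+ m * t ^+ m.
        by rewrite !mulr_ge0 ?invr_ge0 ?exprn_ge0 ?normc_ge0 ?ltW.
      have [kq|kq] /= := eqVneq k q; first by rewrite kq subrr normc0 -kq.
      have [ck|ck] := eqVneq (c k) 0; first by rewrite ck mul0r addr0 normc0 !mul0r.
      rewrite addr0 normcM normc_t -!mulrA ler_wpM2l ?normc_ge0 //.
      rewrite -(subnKC (qlt _ kq ck)) -/m exprD.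
      rewrite mulrA [leRHS]mulrC ler_wpM2l ?exprn_ge0 ?(ltW t0) //.
      (* Since r <= 1 and degree k <= key k, r^(key k - m) is at most r^(degree k) / r^m. *)
      apply: le_trans (_ : r ^+ (key k - m) <= _).
        by rewrite lerXn2r // ?nnegrE ?(ltW t0) ?(ltW r0).
      rewrite ler_pdivlMr ?exprn_gt0 // -exprD subnK ?(qlt _ kq ck) //.
      rewrite ler_wiXn2l ?(ltW r0) // keyE -[X in (X <= _)%N]muln1.
      by apply: leq_trans (leq_addr _ _); rewrite leq_mul2l L0 orbT.
    rewrite -!mulr_suml lecR ler_wpM2r ?exprn_ge0 ?(ltW t0) //.
    by rewrite ler_wpM2r ?invr_ge0 ?exprn_ge0 ?(ltW r0).
  have : normc (c q) * t ^+ key q <= (C + M / r ^+ m) * t ^+ m.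
    rewrite -(normc_t (key q)) -normcM mulrDl.
    have -> : c q * (t ^+ key q)%:C = h + - (h - c q * (t ^+ key q)%:C).
      by rewrite opprB addrC subrK.
    by apply: le_trans (le_normcD _ _) _; rewrite normcN lerD.
  by rewrite [t ^+ m]exprS mulrA ler_pM2r // exprn_gt0.
have cq0 : 0 < normc (c q).
  by rewrite lt0r normc_ge0 andbT; apply: contra cq => /eqP /eq0_normc ->.
pose A := C + M / r ^+ m.
have A0 : 0 < A.
  have /(lt_le_trans cq0) : normc (c q) <= A * r by apply: est; rewrite r0 lexx.
  by rewrite pmulr_lgt0.
(* Small enough for [est] to give |c_q| <= |c_q| / 2. *)
pose t := Num.min r (normc (c q) / (2 * A)).
have t0 : 0 < t by rewrite lt_min r0 divr_gt0 // mulr_gt0.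
have := est t; rewrite t0 ge_min lexx -/A => /(_ isT).
have : A * t <= normc (c q) / 2.
  rewrite mulrC -ler_pdivlMr // -mulrA -invfM ge_min lexx orbT //.
by lra.
Qed.

End power_series.

(** * Adjoints and point spectra *)

Lemma adjointE (R : realType) (V W : lmodType R[i]) (dotV : V -> V -> R[i])
    (dotW : W -> W -> R[i]) (A : V -> W) (y : W) (z : V) :
  (forall x, dotV x z = dotW (A x) y) ->
  (forall z1 z2, (forall x, dotV x z1 = dotV x z2) -> z1 = z2) ->
  adjoint dotV dotW A y = z.
Proof.
move=> zA nondeg; rewrite /adjoint; case: xgetP => [z' _ z'A|/(_ z)]; last by case.
by apply: nondeg => x; rewrite z'A.
Qed.

Lemma inner_nondegenerate (R : realType) (T : choiceType) (x y : l2 R T) :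
  (forall z, inner z x = inner z y) -> x = y.
Proof.
move=> xy; apply/eqP; rewrite -subr_eq0; apply/eqP/inner_eq0.
by rewrite innerBr xy subrr.
Qed.

Section spectra.
Variables (R : realType) (n : nat) (mu : weight R n).
Local Notation word := (word n).
Local Notation multi_index := (multi_index n).
Local Notation Fock := (l2 R word).
Local Notation bmu := (weight_prod mu).
Local Notation omega := (class_weight mu).
Local Notation Y := (class_vector mu).
Implicit Types (l : 'rV[R[i]^o]_n).

Lemma symFock_val_eq0 (x : symFock mu) : (symFock_val x == 0) = (x == 0).
Proof.
by apply/eqP/eqP => [x0|-> //]; apply: (val_inj : injective (@symFock_val R n mu)).
Qed.

Lemma sym_inner_nondegenerate (x y : symFock mu) :
  (forall z, sym_inner z x = sym_inner z y) -> x = y.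
Proof.
move=> xy; apply: val_inj; apply/eqP; rewrite -subr_eq0; apply/eqP/inner_eq0.
by rewrite innerBr; apply/eqP; rewrite subr_eq0; apply/eqP/(xy (x - y)).
Qed.

Lemma adjoint_left_shiftE i (x : Fock) :
  adjoint (@inner R _) (@inner R _) (left_shift mu i) x = adjoint_left_shift mu i x.
Proof.
by apply: adjointE => [y|]; [rewrite inner_left_shift|exact: inner_nondegenerate].
Qed.

Lemma inner_sym_shift i (x y : symFock mu) :
  inner (sym_shift i x) y = inner x (adjoint_left_shift mu i y).
Proof. by rewrite /sym_shift sym_projP inner_left_shift. Qed.

Lemma adjoint_sym_shiftE i (x : symFock mu) :
  symFock_val (adjoint (@sym_inner R n mu) (@sym_inner R n mu) (sym_shift i) x) =
  adjoint_left_shift mu i x.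
Proof.
rewrite (@adjointE _ _ _ _ _ _ _ (SymFock (adjoint_left_shift_sym i (symFockP x)))) //.
- by move=> y; rewrite /sym_inner inner_sym_shift.
- exact: sym_inner_nondegenerate.
Qed.

(** The [i]-th eigenvalue equation at [a] is the recursion mu(i a) x(i a) = l_i x(a), so the vacuum
    coordinate determines [x]. *)
Lemma joint_eigenvector_val (x : Fock) l :
  (forall i, adjoint_left_shift mu i x = l ord0 i *: x) ->
  forall a, x a = word_eval l a / (bmu a)%:C * x [::].
Proof.
move=> xl; elim=> [|i a IH]; first by rewrite /word_eval big_nil /= divr1 mul1r.
have := congr1 (fun y : Fock => y a) (xl i); rewrite l2_scaleE /= IH => ia.
have m0 : (mu (i :: a))%:C != 0 by rewrite (inj_eq (@complexI R)) gt_eqF ?weight_gt0.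
have b0 : (bmu a)%:C != 0 by rewrite (inj_eq (@complexI R)) gt_eqF ?weight_prod_gt0.
rewrite -[LHS](mulKf m0) ia /word_eval big_cons /= [(mu _ * _)%:C]rmorphM /=.
by field; rewrite m0 b0.
Qed.

Lemma joint_eigenvalue_domain (x : Fock) l : x != 0 ->
  (forall i, adjoint_left_shift mu i x = l ord0 i *: x) -> weight_domain mu l.
Proof.
move=> x0 /joint_eigenvector_val xE.
have xn0 : x [::] != 0.
  apply: contra x0 => /eqP xn; apply/eqP/val_inj/funext => a.
  by rewrite /= xE xn mulr0.
have nx0 : 0 < normc (x [::]) ^+ 2.
  rewrite exprn_gt0 // lt0r normc_ge0 andbT.
  by apply: contra xn0 => /eqP /eq0_normc ->.
apply/esum_ltyP => [a|]; first by rewrite divr_ge0 // sqr_ge0.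
exists (sqnorm x / normc (x [::]) ^+ 2) => F.
rewrite ler_pdivlMr // mulr_suml; apply: le_trans (sum_le_sqnorm x F).
apply: ler_sum => a _; rewrite (xE a) !normcM normcV !exprMn exprVn.
by rewrite [X in _ / X * _ <= _]/(bmu a ^+ 2) [normc (bmu a)%:C ^+ 2]normc_sqr /= expr0n addr0.
Qed.

(** The kernel at lambda has eigenvalues conj(lambda_i), so the eigenvector for [l] is the kernel at
    the conjugate point. *)
Definition conj_row l : 'rV[R[i]^o]_n := \row_i ((l ord0 i)^* : R[i]).

Lemma word_eval_conj l a : word_eval (conj_row l) a = (word_eval l a)^*.
Proof. by rewrite /word_eval rmorph_prod; apply: eq_bigr => i _; rewrite mxE. Qed.

Lemma normc_conj (z : R[i]) : normc (z^*) = normc z.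
Proof. by apply: complexI; rewrite -!normC_normc norm_conjC. Qed.

Lemma weight_domain_conj l : weight_domain mu l -> weight_domain mu (conj_row l).
Proof.
rewrite /weight_domain /= (_ : (fun a => _) =
    fun a => (normc (word_eval (conj_row l) a) ^+ 2 / bmu a ^+ 2)%:E) //.
by apply/funext => a; rewrite word_eval_conj normc_conj.
Qed.

Lemma eigen_kernel_neq0 (l : weight_domain mu) : eigen_kernel l != 0.
Proof.
apply/eqP => /(congr1 (fun x : Fock => x [::])) /=.
by rewrite /word_eval big_nil conjC1 divr1 => /eqP; rewrite oner_eq0.
Qed.

Lemma adjoint_left_shift_kernel i (l : weight_domain mu) :
  adjoint_left_shift mu i (eigen_kernel l) = (val l ord0 i)^* *: eigen_kernel l.
Proof.
apply: val_inj; apply/funext => a; rewrite [RHS]l2_scaleE /=.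
rewrite /word_eval big_cons rmorphM /= [(mu _ * _)%:C]rmorphM invfM.
have m0 : (mu (i :: a))%:C != 0 by rewrite (inj_eq (@complexI R)) gt_eqF ?weight_gt0.
by rewrite mulrCA [_%:C * _]mulrA mulfV // mul1r mulrA.
Qed.

Let kernel_at l (Dl : weight_domain mu l) : exists x : symFock mu,
  x != 0 /\ forall i, adjoint_left_shift mu i x = l ord0 i *: symFock_val x.
Proof.
pose l' : weight_domain mu := SigSub (mem_set (weight_domain_conj Dl)).
exists (SymFock (eigen_kernel_sym l')); split.
  by rewrite -symFock_val_eq0 eigen_kernel_neq0.
by move=> i; rewrite adjoint_left_shift_kernel /= mxE conjCK.
Qed.

Lemma point_spectrum_left_shift :
  point_spectrum (fun i => adjoint (@inner R _) (@inner R _) (left_shift mu i)) =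
  weight_domain mu.
Proof.
apply/seteqP; split => [l [x [x0 xl]]|l /kernel_at[x [x0 xl]]].
  by apply: (joint_eigenvalue_domain x0) => i; rewrite -xl adjoint_left_shiftE.
exists (symFock_val x); split=> [|i]; last by rewrite adjoint_left_shiftE xl.
by rewrite symFock_val_eq0.
Qed.

Lemma point_spectrum_sym_shift :
  point_spectrum (fun i => adjoint (@sym_inner R n mu) (@sym_inner R n mu) (sym_shift i)) =
  weight_domain mu.
Proof.
apply/seteqP; split => [l [x [x0 xl]]|l /kernel_at[x [x0 xl]]].
  apply: (@joint_eigenvalue_domain (symFock_val x)) => [|i].
    by rewrite symFock_val_eq0.
  by rewrite -adjoint_sym_shiftE xl.
exists x; split=> // i; apply: val_inj.
by rewrite [LHS]adjoint_sym_shiftE xl.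
Qed.

End spectra.

(** * Boundedness by Baire category *)

Section bounded_operators.
Variable R : realType.

(* Baire's theorem for complex scalars, in the form needed here: the sets where [T]
   exceeds [m] are open, and dense if [T] is unbounded on every ball. *)
Lemma lower_semicontinuous_bounded (V W : normedModType R[i]) (T : V -> W) :
  complete_space V -> linear T ->
  (forall x c, c < `|T x| -> \forall y \near x, c < `|T y|) -> continuous T.
Proof.
move=> Vc Tlin Tlsc.
have TB x y : T (x - y) = T x - T y.
  by rewrite addrC -scaleN1r Tlin scaleN1r addrC.
(* A bound on any ball suffices, since T x = T (x0 + x) - T x0. *)
suff [x0 [r [c [r0 Tc]]]] : exists x0, exists r c : R, 0 < r /\
    forall y, `|x0 - y| <= r%:C -> `|T y| <= c%:C.
  apply: (@bounded_unit_continuous _ _ _ _ r (c + c)) => // x xr.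
  have -> : T x = T (x0 + x) - T x0 by rewrite -TB addrAC subrr add0r.
  rewrite rmorphD; apply: le_trans (ler_normB _ _) _; rewrite lerD // Tc //.
    by rewrite opprD addrA subrr add0r normrN.
  by rewrite subrr normr0 ler0c ltW.
apply: contrapT => unb.
have big x0 (r : R) (m : nat) : 0 < r -> exists y, exists s : R,
    [/\ 0 < s, s <= r / 2, `|x0 - y| <= (r / 2)%:C &
        forall z, `|y - z| <= s%:C -> m%:R%:C < `|T z|].
  move=> r0; have r20 : 0 < r / 2 by rewrite divr_gt0.
  have [y [yr Ty]] : exists y, `|x0 - y| <= (r / 2)%:C /\ m%:R%:C < `|T y|.
    apply: contrapT => ny; apply: unb; exists x0, (r / 2), m%:R; split=> // y yr.
    rewrite normr_Re lecR leNgt; apply/negP => Ty; apply: ny; exists y; split=> //.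
    by rewrite normr_Re ltcR.
  have /nbhs_ballP[_ /posC[s s0 ->] sP] := Tlsc _ _ Ty.
  (* s / 2 puts the closed ball inside the open one where |T| exceeds m; r / 2 keeps it inside the
     previous ball. *)
  exists y, (Num.min (s / 2) (r / 2)); split=> //.
  - by rewrite lt_min r20 divr_gt0.
  - by rewrite ge_min lexx orbT.
  move=> z yz; apply: sP; rewrite -ball_normE /=; apply: le_lt_trans yz _.
  by rewrite ltcR gt_min; apply/orP; left; lra.
have /choice[f fP] (p : nat * V * {r : R | 0 < r}) : exists q : V * {r : R | 0 < r},
    [/\ val q.2 <= val p.2 / 2, `|p.1.2 - q.1| <= (val p.2 / 2)%:C &
        forall z, `|q.1 - z| <= (val q.2)%:C -> p.1.1%:R%:C < `|T z|].
  case: p => [[m x0] [r r0]]; have [y [s [s0 sr xy yT]]] := big x0 r m r0.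
  by exists (y, exist _ s s0).
pose fix g m : V * {r : R | 0 < r} :=
  if m is m'.+1 then f (m', (g m').1, (g m').2) else (0, exist _ 1 ltr01).
pose x m := (g m).1; pose r m := val (g m).2.
have gP m : [/\ r m.+1 <= r m / 2, `|x m - x m.+1| <= (r m / 2)%:C &
    forall z, `|x m.+1 - z| <= (r m.+1)%:C -> m%:R%:C < `|T z|].
  exact: (fP (m, (g m).1, (g m).2)).
have r_gt0 m : 0 < r m by rewrite /r; case: ((g m).2).
have nest m k z : `|x (m + k)%N - z| <= (r (m + k)%N)%:C -> `|x m - z| <= (r m)%:C.
  elim: k => [|k IH]; first by rewrite addn0.
  rewrite addnS => xz; apply: IH; have [rr xx _] := gP (m + k)%N.
  rewrite -(subrKA (x (m + k).+1)); apply: le_trans (ler_normD _ _) _.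
  apply: le_trans (lerD xx xz) _; rewrite -rmorphD lecR; lra.
(* Weaker than the halving provides, but directly comparable with the archimedean property. *)
have r_small m : r m <= m.+1%:R^-1.
  elim: m => [|m IH]; first by rewrite invr1.
  have [rr _ _] := gP m; apply: le_trans rr _; apply: le_trans (ler_wpM2r _ IH) _ => //.
  by rewrite -invfM lef_pV2 ?posrE ?mulr_gt0 // -natrM ler_nat; lia.
have xx m k : `|x m - x (m + k)%N| <= (r m)%:C.
  by apply: (nest m k); rewrite subrr normr0 ler0c ltW.
have : cvg (x @ \oo).
  apply: Vc; apply: cauchy_exP => _ /posC[e e0 ->].
  have [m me] : exists m, r m < e.
    exists (Num.truncn e^-1); apply: le_lt_trans (r_small _) _.
    by rewrite invf_plt ?posrE // truncnS_gt.
  exists (x m), m => // k /= mk; rewrite -ball_normE /= -(subnKC mk).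
  by apply: le_lt_trans (xx _ _) _; rewrite ltcR.
move=> /cvg_ex[l xl].
have lin_ball m : `|x m - l| <= (r m)%:C.
  rewrite normr_Re lecR; apply/ler_addgt0Pr => e e0.
  have eC : 0 < e%:C by rewrite ltcR.
  have /cvgrPdist_lt /(_ _ eC)[N _ NP] := xl.
  have := NP _ (leq_addl m N); rewrite /= => /ltW xe.
  rewrite -lecR -normr_Re rmorphD -(subrKA (x (m + N)%N)).
  by apply: le_trans (ler_normD _ _) _; rewrite lerD // distrC.
(* The limit lies in every ball, so |T l| would exceed every natural number. *)
have [m Tm] : exists m : nat, complex.Re `|T l| < m%:R.
  by exists (Num.truncn (complex.Re `|T l|)).+1; rewrite truncnS_gt.
have [_ _ /(_ l (lin_ball _))] := gP m.
by rewrite normr_Re ltcR ltNge ltW.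
Qed.

End bounded_operators.

(** * Uniqueness and growth of power series near the origin *)

Section power_series_growth.
Variables (R : realType) (n : nat).
Implicit Types (k q : multi_index n) (l : 'rV[R[i]^o]_n).

(** The case [C = 0] of [power_series_order]: a vanishing sum is small to every order. *)
Lemma power_series_unique (c : multi_index n -> R[i]) (r M : R) : 0 < r <= 1 ->
  (forall F : {fset multi_index n}, \sum_(k <- F) normc (c k) * r ^+ degree k <= M) ->
  (forall l, (forall i, normc (l ord0 i) <= r) ->
    has_sum (fun k => c k * monomial l k : R[i]^o) 0) ->
  forall k, c k = 0.
Proof.
move=> r01 cM c0 k.
apply: (power_series_order r01 (lexx 0) cM _ (leqnn (degree k))) => l s /andP[s0 sr] ls.
exists 0; last by rewrite normc0 mul0r.
by apply: c0 => i; exact: le_trans (ls i) sr.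
Qed.

(** The converse estimate to [power_series_order]: a monomial of degree at least [m] is at most s^m
    r^(degree k - m). *)
Lemma power_series_bound (c : multi_index n -> R[i]) (r M s : R) (m : nat) l (h : R[i]^o) :
  (forall F : {fset multi_index n}, \sum_(k <- F) normc (c k) * r ^+ degree k <= M) ->
  (forall k, (degree k < m)%N -> c k = 0) ->
  0 < s <= r -> (forall i, normc (l ord0 i) <= s) ->
  has_sum (fun k => c k * monomial l k : R[i]^o) h -> normc h <= M / r ^+ m * s ^+ m.
Proof.
move=> cM cm /andP[s0 sr] ls hsum; have r0 : 0 < r by exact: lt_le_trans sr.
rewrite -lecR -normC_normc; apply: (has_sum_le hsum) => F.
apply: le_trans (ler_norm_sum _ _ _) _.
apply: le_trans (_ : (\sum_(k <- F) normc (c k) * r ^+ degree k / r ^+ m * s ^+ m)%:C <= _).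
  rewrite [leRHS]rmorph_sum; apply: ler_sum => k _; rewrite normC_normc lecR normcM.
  have [km|km] := ltnP (degree k) m; first by rewrite cm // normc0 !mul0r.
  rewrite -!mulrA ler_wpM2l ?normc_ge0 //; apply: le_trans (normc_monomial_le _ ls) _.
  rewrite -(subnKC km) !exprD mulrA [leRHS]mulrC ler_wpM2l ?exprn_ge0 ?(ltW s0) //.
  rewrite mulrAC mulfV ?gt_eqF ?exprn_gt0 // mul1r.
  by rewrite lerXn2r // ?nnegrE ?(ltW s0) ?(ltW r0).
rewrite -!mulr_suml lecR ler_wpM2r ?exprn_ge0 ?(ltW s0) //.
by rewrite ler_wpM2r ?invr_ge0 ?exprn_ge0 ?(ltW r0).
Qed.

Lemma low_degree_finite (d : nat) : finite_set [set k : multi_index n | (degree k <= d)%N].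
Proof.
apply: (@sub_finite_set _ _ (range (fun f : {ffun 'I_n -> 'I_d.+1} =>
    [ffun i => val (f i)] : multi_index n))); last exact/finite_image/finite_finset.
move=> k /= kd; exists [ffun i => inord (k i)] => //.
apply/ffunP => i; rewrite !ffunE /= inordK // ltnS (leq_trans _ kd) //.
by rewrite /degree (bigD1 i) //= leq_addr.
Qed.

Definition low_degree (d : nat) : {fset multi_index n} :=
  fset_set [set k : multi_index n | (degree k <= d)%N].

Lemma mem_low_degree d k : (k \in low_degree d) = (degree k <= d)%N.
Proof. by rewrite in_fset_set; last exact: low_degree_finite; apply/idP/idP; rewrite inE. Qed.

End power_series_growth.

(** * The unitary onto the Hardy space *)

Section symmetric_space.
Variables (R : realType) (n : nat) (mu : weight R n).
Local Notation word := (word n).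
Local Notation multi_index := (multi_index n).
Local Notation Fock := (l2 R word).
Local Notation bmu := (weight_prod mu).
Local Notation omega := (class_weight mu).
Local Notation Y := (class_vector mu).
Local Notation D := (weight_domain mu).
Local Notation H := (symFock mu).

Let omegaC_neq0 k : (omega k)%:C != 0.
Proof. by rewrite (inj_eq (@complexI R)) gt_eqF ?class_weight_gt0. Qed.

Lemma symFock_val_sum (I : Type) (s : seq I) (f : I -> H) :
  symFock_val (\sum_(i <- s) f i) = \sum_(i <- s) symFock_val (f i).
Proof. by elim/big_rec2: _ => // i y1 y2 _ <-. Qed.

Lemma symFock_normE (x : H) : `|x| = `|symFock_val x|.
Proof. exact: erefl. Qed.

Lemma sym_has_sumP (I : choiceType) (f : I -> H) (x : H) :
  has_sum f x <-> has_sum (fun i => symFock_val (f i)) (symFock_val x).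
Proof.
by split=> /has_sumP fx; apply/has_sumP => e /fx[F0 F0P]; exists F0 => F /F0P;
  rewrite symFock_normE /= symFock_val_sum.
Qed.

Lemma sym_expansionP (x : H) (c : multi_index -> R[i]) :
  sym_expansion x c <-> c = sym_coef mu x.
Proof.
rewrite /sym_expansion sym_has_sumP; split=> [cx|->]; last exact: sym_expand (symFockP x).
by apply/funext => k; rewrite (class_expansion_coef k cx).
Qed.

Lemma sym_coef_inj (x y : H) : sym_coef mu x = sym_coef mu y -> x = y.
Proof.
have expand (z : H) : sym_expansion z (sym_coef mu z) by apply/sym_expansionP.
by move=> xy; apply: has_sum_unique (expand x) _; rewrite xy; exact: expand.
Qed.

Lemma sym_coef_lin (a : R[i]) (x y : Fock) k :
  sym_coef mu (a *: x + y) k = a * sym_coef mu x k + sym_coef mu y k.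
Proof. by rewrite /sym_coef /fourier inner_linl mulrDl mulrA. Qed.

Lemma sym_coef_basis j k : sym_coef mu (Y j) k = (j == k)%:R.
Proof.
apply: (@class_expansion_coef _ _ _ (fun k => (j == k)%:R)).
have := @has_sum_single _ _ _ (fun k => (j == k)%:R *: Y k : Fock) j.
rewrite eqxx scale1r; apply=> i; rewrite eq_sym => /negbTE ->; exact: scale0r.
Qed.

Lemma symFock_complete : complete_space H.
Proof.
move=> F FF /cauchyP Fc.
have FvF : ProperFilter ((@symFock_val R n mu) @ F) by exact: fmap_proper_filter.
have /cvg_ex[y Fy] : cvg ((@symFock_val R n mu) @ F).
  apply: l2_complete; apply: cauchy_exP => e /Fc[x Fx].
  exists (symFock_val x).
  have : F ((@symFock_val R n mu) @^-1` ball (symFock_val x) e); last by [].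
  by apply: filterS Fx => z; rewrite -!ball_normE.
have ys : y \in symFock_set mu.
  apply/asboolP; apply: (closed_cvg (closure (lin_span Y)) _ _ _ Fy).
    exact: closed_closure.
  by apply: nearW => x; have /asboolP := symFockP x.
apply/cvg_ex; exists (SymFock ys); apply/cvgrPdist_le => e e0.
by move/cvgrPdist_le : Fy => /(_ _ e0).
Qed.

Lemma sym_coef_continuous (V : normedModType R[i]) (v : V) k :
  continuous (fun x : H => sym_coef mu x k *: v).
Proof.
(* Bessel gives |c_k|^2 <= omega k on the unit ball, and 2 |c_k| <= 1 + |c_k|^2. *)
apply: (@bounded_unit_continuous _ _ _ _ 1 ((1 + omega k) * complex.Re `|v|)) => //.
  by move=> a x y; rewrite sym_coef_lin scalerDl scalerA.
move=> x; rewrite symFock_normE l2_norm_le // expr1n => x1.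
rewrite normrZ rmorphM /= RRe_real ?ger0_real // ler_wpM2r // normC_normc lecR.
have := le_trans (sym_bessel mu x [fset k]%fset) x1.
rewrite big_seq_fset1 ler_pdivrMr ?class_weight_gt0 // mul1r => ck.
have := sqr_ge0 (normc (sym_coef mu x k) - 1); have := omega_ge0 mu k.
by rewrite sqrrB expr1n mulr1; lra.
Qed.

Lemma sym_norm_partial_le (x : H) (F : {fset multi_index}) :
  `|\sum_(k <- F) sym_coef mu x k *: sym_basis mu k| <= `|x|.
Proof.
rewrite !symFock_normE symFock_val_sum.
rewrite [leRHS]l2_normE l2_norm_le ?sqrtr_ge0 // sqr_sqrtr ?sqnorm_ge0 //.
have := @sqnorm_partial _ _ _ Y _ (class_vector_self mu) (@class_vector_orth _ _ mu)
  (sym_coef mu x) F.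
by move=> /= ->; exact: sym_bessel.
Qed.

Lemma sym_coef_kernel (l : D) k :
  sym_coef mu (eigen_kernel l) k = (monomial (val l) k)^* * (omega k)%:C.
Proof.
rewrite sym_coefE class_weightE rmorph_sum mulr_sumr; apply: eq_big_seq => a.
rewrite mem_class_words => /eqP ak /=; rewrite word_evalE ak -mulrA -fmorphV -rmorphM.
by rewrite -invfM -expr2.
Qed.

Definition sym_eval (x : H) (l : D) : R[i]^o := inner x (eigen_kernel l).

Lemma sym_eval_basis k l : sym_eval (sym_basis mu k) l = monomial (val l) k.
Proof.
rewrite /sym_eval innerC inner_sym_coef sym_coef_kernel mulfK ?conjCK //.
Qed.

Lemma sym_eval_power_series (x : H) : power_series (sym_coef mu x) (sym_eval x).
Proof.
move=> l; have := has_sum_innerl (y := eigen_kernel l) (sym_expand (symFockP x)).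
congr (has_sum _ _); apply/funext => k; rewrite innerZl -(sym_eval_basis k l) //.
Qed.

Lemma sym_eval_hardy_coef (x : H) : hardy_coef (sym_eval x) (sym_coef mu x).
Proof.
split; last exact: sym_eval_power_series.
apply/esum_ltyP => [k|]; first by rewrite divr_ge0 ?sqr_ge0 ?omega_ge0.
by exists (sqnorm x); exact: sym_bessel.
Qed.

Lemma sym_eval_hardy (x : H) : sym_eval x \in @hardy_set R n mu.
Proof. by apply/asboolP; exists (sym_coef mu x); exact: sym_eval_hardy_coef. Qed.

Definition to_hardy (x : H) : hardy mu := Hardy (sym_eval_hardy x).

Lemma to_hardy_linear : linear to_hardy.
Proof.
by move=> a x y; apply: val_inj; apply/funext => l; exact: inner_linl.
Qed.

(** Surjectivity of U by Riesz-Fischer. Keeping [c] in the conclusion is what later identifies the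
    family chosen by [coef]. *)
Lemma hardy_coef_sym (f : D -> R[i]^o) c : hardy_coef f c ->
  exists x : H, sym_coef mu x = c /\ f = sym_eval x.
Proof.
move=> [/esum_ltyP []]; first by move=> k; rewrite divr_ge0 ?sqr_ge0 ?omega_ge0.
move=> M /class_expansion_exists[x xs cx] fc.
have xc : sym_coef mu x = c by apply/funext => k; exact: class_expansion_coef cx.
exists (SymFock xs); split=> //; apply/funext => l; apply: has_sum_unique (fc l) _.
by rewrite -xc; exact: (@sym_eval_power_series (SymFock xs) l).
Qed.

Lemma to_hardy_surj (f : hardy mu) : exists x, to_hardy x = f.
Proof.
have /asboolP[c /hardy_coef_sym[x [_ fx]]] := hardyP f.
by exists x; apply: val_inj.
Qed.

Lemma sym_eval_shift i (x : H) l : sym_eval (sym_shift i x) l = val l ord0 i * sym_eval x l.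
Proof.
rewrite /sym_eval -[eigen_kernel l]/(symFock_val (SymFock (eigen_kernel_sym l))).
by rewrite inner_sym_shift /= adjoint_left_shift_kernel innerZr conjCK.
Qed.

Section near_origin.
Hypothesis D0 : nbhs (0 : 'rV[R[i]^o]_n) D.

Lemma polydisc_sub : exists2 r : R, 0 < r <= 1 &
  forall l : 'rV[R[i]^o]_n, (forall i, normc (l ord0 i) <= r) -> D l.
Proof.
have /nbhs_ballP[_ /posC[e e0 ->] eD] := D0.
exists (Num.min 1 (e / 2)); first by rewrite lt_min ltr01 divr_gt0 // ge_min lexx.
move=> l lr; apply: eD; split=> [|i j]; rewrite ?ltcR //.
rewrite mxE -ball_normE /= sub0r normrN.
rewrite (ord1 i) normC_normc ltcR; apply: le_lt_trans (lr j) _.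
rewrite gt_min; apply/orP; right; lra.
Qed.

Lemma sym_coef_summable (x : Fock) (r : R) : 0 <= r -> D (const_mx r%:C) ->
  exists M, forall F : {fset multi_index},
    \sum_(k <- F) normc (sym_coef mu x k) * r ^+ degree k <= M.
Proof.
move=> r0 Dr; pose l : D := SigSub (mem_set Dr); pose z := eigen_kernel l.
exists (sqnorm x + sqnorm z) => F.
apply: le_trans (lerD (sym_bessel mu x F) (sym_bessel mu z F)).
rewrite -big_split /=; apply: ler_sum => k _.
have -> : normc (sym_coef mu z k) = r ^+ degree k * omega k.
  rewrite sym_coef_kernel normcM normc_conj.
  have -> : monomial (val l) k = (r ^+ degree k)%:C.
    rewrite /degree (big_morph (fun p => r ^+ p) (exprD _) (expr0 _)) rmorph_prod.
    by apply: eq_bigr => i _; rewrite /= mxE -rmorphXn.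
  rewrite -normcM -rmorphM; apply: complexI.
  by rewrite -normC_normc ger0_norm // ler0c mulr_ge0 ?exprn_ge0 ?omega_ge0.
have w0 := class_weight_gt0 mu k.
set c := normc _; set p := r ^+ _; set w := class_weight mu k in w0 *.
have -> : (p * w) ^+ 2 / w = p ^+ 2 * w by field; rewrite gt_eqF.
(* A weighted form of c p <= c^2 / w + p^2 w, with the difference written as a sum of squares. *)
rewrite -subr_ge0 (_ : _ - _ = ((c - p * w) ^+ 2 + c ^+ 2 + (p * w) ^+ 2) / (2 * w)).
  by rewrite divr_ge0 ?addr_ge0 ?sqr_ge0 // mulr_ge0 // ltW.
by field; rewrite gt_eqF.
Qed.

(** Through this lemma the neighborhood hypothesis enters. One radius serves all vectors; only the
    bound [M] depends on [x]. *)
Lemma summable_radius : exists2 r : R, 0 < r <= 1 &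
  (forall l : 'rV[R[i]^o]_n, (forall i, normc (l ord0 i) <= r) -> D l) /\
  forall x : Fock, exists M, forall F : {fset multi_index},
    \sum_(k <- F) normc (sym_coef mu x k) * r ^+ degree k <= M.
Proof.
have [r r01 rD] := polydisc_sub; exists r => //; split=> // x.
have r0 : 0 <= r by case/andP: r01 => /ltW.
apply: sym_coef_summable => //; apply: rD => i.
by rewrite mxE -lecR -normC_normc ger0_norm // ler0c.
Qed.

Lemma sym_eval_inj : injective sym_eval.
Proof.
move=> x y xy; apply/eqP; rewrite -subr_eq0; apply/eqP/sym_coef_inj/funext => k.
have xy0 l : sym_eval (x - y) l = 0.
  by have := congr1 (fun f => f l) xy; rewrite /sym_eval innerBl => ->; rewrite subrr.
have [r r01 [rD rM]] := summable_radius.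
have [M cM] := rM (x - y).
have -> : sym_coef mu (0 : H) k = 0 by rewrite /sym_coef /fourier inner0l mul0r.
apply: (power_series_unique r01 cM) => l lr.
by have := @sym_eval_power_series (x - y) (SigSub (mem_set (rD l lr))); rewrite xy0.
Qed.

Lemma to_hardy_inj : injective to_hardy.
Proof. by move=> x y [] /sym_eval_inj. Qed.

Lemma coef_to_hardy (x : H) : coef (to_hardy x) = sym_coef mu x.
Proof.
have : hardy_coef (to_hardy x) (coef (to_hardy x)).
  by rewrite /coef; apply: xgetPex; exists (sym_coef mu x); exact: sym_eval_hardy_coef.
by move=> /hardy_coef_sym[y [<- /sym_eval_inj ->]].
Qed.

Lemma hardy_inner_to_hardy (x y : H) :
  hardy_inner (to_hardy x) (to_hardy y) = sym_inner x y.
Proof.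
rewrite /hardy_inner !coef_to_hardy; apply: (@has_sum_sum _ _ R[i]^o).
have := has_sum_innerl (y := y) (sym_expand (symFockP x)).
congr (has_sum _ _); apply/funext => k; rewrite innerZl innerC inner_sym_coef.
rewrite rmorphM fmorphV /= [(_%:C)^*]conjc_real mulrA //.
Qed.

Lemma to_hardy_unitary : unitary (@sym_inner R n mu) (@hardy_inner R n mu) to_hardy.
Proof.
split; [exact: to_hardy_linear| |exact: hardy_inner_to_hardy].
exists (fun f => sval (cid (to_hardy_surj f))) => [x|f].
  by apply: to_hardy_inj; case: cid.
by case: cid.
Qed.

Lemma to_hardy_monomial_unitary : monomial_unitary to_hardy.
Proof. by split; [exact: to_hardy_unitary|exact: sym_eval_basis]. Qed.

(** Inner products with the images of the y^(k) already fix every coefficient, so no density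
    argument is involved. *)
Lemma monomial_unitary_unique (U : H -> hardy mu) : monomial_unitary U -> U = to_hardy.
Proof.
move=> [[_ _ Udot] Ubasis]; apply/funext => x.
have [y yx] := to_hardy_surj (U x); rewrite -yx; congr to_hardy.
apply: sym_coef_inj; apply/funext => k.
rewrite /sym_coef /fourier; congr (_ / _).
rewrite -[LHS]/(sym_inner y (sym_basis mu k)) -[RHS]/(sym_inner x (sym_basis mu k)).
rewrite -hardy_inner_to_hardy -Udot yx; congr (hardy_inner _ _).
by apply: val_inj; apply/funext => l; rewrite [RHS]Ubasis [LHS]sym_eval_basis.
Qed.

Lemma adjoint_to_hardy (x : H) :
  adjoint (@sym_inner R n mu) (@hardy_inner R n mu) to_hardy (to_hardy x) = x.
Proof.
apply: adjointE => [y|]; first by rewrite hardy_inner_to_hardy.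
exact: sym_inner_nondegenerate.
Qed.

End near_origin.
End symmetric_space.

Lemma has_sumZ (R : realType) (I : choiceType) (V : normedModType R[i]) (a : R[i])
    (f : I -> V) (l : V) : has_sum f l -> has_sum (fun i => a *: f i) (a *: l).
Proof.
move=> fl; have f0 : has_sum (fun _ : I => 0 : V) (0 : V).
  by have := @has_sum_fin _ I V (fun=> 0) fset0 (fun _ _ => erefl); rewrite big_seq_fset0.
have := has_sum_lin (a := a) fl f0; rewrite addr0.
by under eq_fun do rewrite addr0.
Qed.

Lemma linear_scale (R : pzRingType) (V W : lmodType R) (L : V -> W) (a : R) (v : V) :
  linear L -> L (a *: v) = a *: L v.
Proof.
move=> Llin; have L0 : L 0 = 0.
  by have := Llin 1 0 0; rewrite scaler0 addr0 scale1r -[LHS]addr0 => /addrI.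
by have := Llin a v 0; rewrite !addr0 L0 addr0.
Qed.

Lemma continuous_sum (R : realType) (I : Type) (V W : normedModType R[i]) (s : seq I)
    (f : I -> V -> W) : (forall i, continuous (f i)) ->
  continuous (fun x => \sum_(i <- s) f i x).
Proof.
move=> fc; elim: s => [|i s IH] x.
  by under eq_fun do rewrite big_nil; exact: cvg_cst.
by under eq_fun do rewrite big_cons; apply: cvgD; [exact: fc|exact: IH].
Qed.

(** * Multipliers and the commutant *)

Section multipliers.
Variables (R : realType) (n : nat) (mu : weight R n).
Local Notation word := (word n).
Local Notation multi_index := (multi_index n).
Local Notation omega := (class_weight mu).
Local Notation D := (weight_domain mu).
Local Notation H := (symFock mu).
Local Notation Y := (sym_basis mu).
Local Notation one := (vacuum mu).
Local Notation B := (sym_shift (mu := mu)).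
Hypothesis D0 : nbhs (0 : 'rV[R[i]^o]_n) D.

(** The working form of M_phi = U A U^*, free of the default values in [mult_op] and [adjoint];
    [multipliesE] translates. *)
Definition multiplies (phi : D -> R[i]^o) (A : H -> H) : Prop :=
  forall x l, sym_eval (A x) l = phi l * sym_eval x l.

Lemma sym_eval_one l : sym_eval one l = 1.
Proof.
rewrite /sym_eval innerC inner_fock_basis /= /word_eval big_nil.
by rewrite conjC1 divr1 conjC1.
Qed.

Lemma multiplies_one (phi : D -> R[i]^o) A : multiplies phi A -> phi = sym_eval (A one).
Proof. by move=> Aphi; apply/funext => l; rewrite Aphi sym_eval_one mulr1. Qed.

Lemma sym_eval_lin (a : R[i]) (x y : H) l :
  sym_eval (a *: x + y) l = a * sym_eval x l + sym_eval y l.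
Proof. exact: inner_linl. Qed.

Lemma multiplies_linear (phi : D -> R[i]^o) A : multiplies phi A -> linear A.
Proof.
move=> Aphi a x y; apply: (sym_eval_inj D0); apply/funext => l.
by rewrite Aphi !sym_eval_lin !Aphi mulrDr mulrCA.
Qed.

Definition word_shift (a : word) (x : H) : H := foldr (fun i => B i) x a.

Lemma multiplies_word_shift a : multiplies (fun l => word_eval (val l) a) (word_shift a).
Proof.
move=> x l; elim: a => [|i a IH] /=; first by rewrite /word_eval big_nil mul1r.
by rewrite sym_eval_shift IH /word_eval big_cons mulrA.
Qed.

Lemma word_shift_basis a k : word_shift a (Y k) = Y (word_class a + k).
Proof.
apply: (sym_eval_inj D0); apply/funext => l.
by rewrite multiplies_word_shift !sym_eval_basis monomialD word_evalE.
Qed.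

Lemma word_shift_one a : word_shift a one = Y (word_class a).
Proof.
apply: (sym_eval_inj D0); apply/funext => l.
by rewrite multiplies_word_shift sym_eval_one mulr1 sym_eval_basis word_evalE.
Qed.

Lemma commutant_word_shift A a x : (forall i, A \o B i = B i \o A) ->
  A (word_shift a x) = word_shift a (A x).
Proof.
move=> AB; elim: a => //= i a <-.
by have := congr1 (fun f => f (word_shift a x)) (AB i).
Qed.

Lemma commutant_multiplies A : commutant B A -> multiplies (sym_eval (A one)) A.
Proof.
move=> [[Alin Ac] AB] x l.
have ev_lin : linear (fun y : H => sym_eval y l : R[i]^o).
  by move=> a y z; exact: inner_linl.
have ev_c : continuous (fun y : H => sym_eval y l : R[i]^o).
  apply: (@bounded_unit_continuous _ _ _ _ 1 (1 + sqnorm (eigen_kernel l))) => // y.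
  rewrite symFock_normE l2_norm_le // expr1n => y1; rewrite normC_normc lecR.
  by apply: le_trans (norm_inner_le _ _) _; rewrite lerD2r.
have xs : sym_expansion x (sym_coef mu x) by apply/sym_expansionP.
have := has_sum_map ev_lin ev_c (has_sum_map Alin Ac xs).
move/has_sum_unique; apply.
have := has_sumZ (a := sym_eval (A one) l) (has_sum_map ev_lin ev_c xs).
congr (has_sum _ _); apply/funext => k /=.
have evZ c (y : H) : sym_eval (c *: y) l = c * sym_eval y l by exact: innerZl.
have AZ b (y : H) : A (b *: y) = b *: A y by exact: linear_scale.
(* For any word of class [k], y^(k) is that product of shifts applied to the vacuum, and [A] passes
   through the shifts. *)
rewrite AZ !evZ; have [a <-] := word_class_surj k.
rewrite -word_shift_one commutant_word_shift // !multiplies_word_shift sym_eval_one.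
rewrite -[LHS]/(_ * _); ring.
Qed.

(* If the coefficients of [x] vanish up to degree [d], then near the origin
   [sym_eval x] is of order [d.+1], hence so is its product with [phi]. *)
Lemma multiplies_low_degree (phi : D -> R[i]^o) A (x : H) (d : nat) : multiplies phi A ->
  (forall k, (degree k <= d)%N -> sym_coef mu x k = 0) ->
  forall k, (degree k <= d)%N -> sym_coef mu (A x) k = 0.
Proof.
move=> Aphi x0; have [r r01 [rD rM]] := summable_radius D0.
have [M xM] := rM x; have [M1 oneM] := rM (A one); have [M2 AM] := rM (A x).
have M0 : 0 <= M by have := xM fset0; rewrite big_seq_fset0.
have M10 : 0 <= M1 by have := oneM fset0; rewrite big_seq_fset0.
have r0 : 0 < r by case/andP: r01.
(* [M1] bounds phi = U(A 1) on the polydisc; M / r^(d+1) is the constant of [power_series_bound] for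
   [x]. *)
apply: (@power_series_order _ _ _ r M2 (M1 * (M / r ^+ d.+1))) => //.
  by rewrite mulr_ge0 // divr_ge0 // exprn_ge0 // ltW.
move=> l s sr ls; have lr i : normc (l ord0 i) <= r.
  by apply: le_trans (ls i) _; case/andP: sr.
pose l' : D := SigSub (mem_set (rD l lr)).
exists (sym_eval (A x) l'); first exact: (@sym_eval_power_series _ _ _ (A x) l').
rewrite Aphi (multiplies_one Aphi) normcM -mulrA ler_pM ?normc_ge0 //.
  have := power_series_bound (m := 0) oneM _ sr ls (@sym_eval_power_series _ _ _ (A one) l').
  by rewrite !expr0 divr1 mulr1; apply.
exact: power_series_bound xM _ sr ls (@sym_eval_power_series _ _ _ x l').
Qed.

(** The part of [x] above degree [degree q] cannot reach the [q]-th coefficient of [A x]. Each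
    coefficient is thus continuous in [x] before [A] is known to be. *)
Lemma multiplies_coef (phi : D -> R[i]^o) A (x : H) q : multiplies phi A ->
  sym_coef mu (A x) q =
    \sum_(k <- low_degree n (degree q)) sym_coef mu x k * sym_coef mu (A (Y k)) q.
Proof.
move=> Aphi; set F := low_degree _ _.
pose A' : {linear H -> H} := HB.pack A (GRing.isLinear.Build _ _ _ _ _ (multiplies_linear Aphi)).
pose cf (y : H) : R[i] := sym_coef mu y q.
have cf_lin : scalar cf by move=> a y z; exact: sym_coef_lin.
pose cf' : {scalar H} := HB.pack cf (GRing.isLinear.Build _ _ _ _ _ cf_lin).
pose x1 : H := \sum_(k <- F) sym_coef mu x k *: Y k.
have low k : (degree k <= degree q)%N -> sym_coef mu (x - x1) k = 0.
  move=> kq; rewrite /sym_coef /fourier.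
  have -> : symFock_val (x - x1) = symFock_val x - symFock_val x1 by [].
  rewrite innerBl symFock_val_sum.
  have := @inner_partial _ _ _ _ _ (class_vector_self mu) (@class_vector_orth _ _ mu)
    (sym_coef mu x) F k.
  rewrite mem_low_degree kq => /= ->.
  by rewrite inner_sym_coef fmorphV subrr mul0r.
have := multiplies_low_degree Aphi low (leqnn _).
rewrite -[A _]/(A' _) -[sym_coef _ _ _]/(cf' _) !linearB /= => /eqP.
rewrite subr_eq0 => /eqP; rewrite /cf => ->.
rewrite -[A x1]/(A' x1) -[LHS]/(cf' _) !linear_sum; apply: eq_bigr => k _.
by rewrite !linearZ.
Qed.

Lemma multiplies_continuous (phi : D -> R[i]^o) A : multiplies phi A -> continuous A.
Proof.
move=> Aphi; apply: lower_semicontinuous_bounded (@symFock_complete _ _ mu) _ _.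
  exact: multiplies_linear Aphi.
move=> x c cx.
(* Partial sums of [A y]: continuous in [y], bounded in norm by |A y|, and at [x] close enough to
   [A x] to exceed [c]. *)
pose P (F : {fset multi_index}) y : H := \sum_(q <- F) sym_coef mu (A y) q *: Y q.
have Pc (F : {fset multi_index}) : continuous (P F).
  have -> : P F = fun y => \sum_(q <- F) \sum_(k <- low_degree n (degree q))
      sym_coef mu y k *: (sym_coef mu (A (Y k)) q *: Y q).
    apply/funext => y; apply: eq_bigr => q _; rewrite (multiplies_coef y q Aphi) scaler_suml.
    by apply: eq_bigr => k _; rewrite scalerA.
  by do 2!apply: continuous_sum => ?; exact: sym_coef_continuous.
have Axs : sym_expansion (A x) (sym_coef mu (A x)) by apply/sym_expansionP.
have [F cF] : exists F : {fset multi_index}, c < `|P F x|.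
  have d0 : 0 < `|A x| - c by rewrite subr_gt0.
  move/cvgrPdist_lt : Axs => /(_ _ d0)[F _ /(_ F (fsubset_refl _))] /=.
  rewrite partial_sumE -/(P F x) => FP; exists F.
  rewrite -(ltrD2l (`|A x| - c)) subrK; apply: le_lt_trans (_ : `|A x - P F x| + `|P F x| < _).
    by rewrite -{1}(subrK (P F x) (A x)) ler_normD.
  by rewrite ltrD2r.
have d0 : 0 < `|P F x| - c by rewrite subr_gt0.
have := Pc F x => /cvgrPdist_lt /(_ _ d0); apply: filterS => y Py.
apply: lt_le_trans (sym_norm_partial_le (A y) F).
rewrite -(ltrD2l (`|P F x| - c)) subrK; apply: le_lt_trans (_ : `|P F x - P F y| + `|P F y| < _).
  by rewrite -{1}(subrK (P F y) (P F x)) ler_normD.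
by rewrite ltrD2r.
Qed.

Lemma multiplies_commutant (phi : D -> R[i]^o) A : multiplies phi A -> commutant B A.
Proof.
move=> Aphi; split.
  by split; [exact: multiplies_linear Aphi|exact: multiplies_continuous Aphi].
move=> i; apply/funext => x; apply: (sym_eval_inj D0); apply/funext => l.
by rewrite /= sym_eval_shift !Aphi sym_eval_shift mulrCA.
Qed.

Lemma multiplies_multiplier (phi : D -> R[i]^o) A : multiplies phi A -> multiplier phi.
Proof.
move=> Aphi f; have [x <-] := to_hardy_surj f.
rewrite (_ : (fun l => _) = sym_eval (A x)); first exact: sym_eval_hardy.
by apply/funext => l; rewrite Aphi.
Qed.

Lemma mult_opE (phi : D -> R[i]^o) (f : hardy mu) l : multiplier phi ->
  mult_op phi f l = phi l * f l.
Proof. by move=> /(_ f) phif; rewrite /mult_op -[hardy_fun _]/(val _) insubdK. Qed.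

Lemma multipliesE (phi : D -> R[i]^o) A : multiplies phi A <->
  multiplier phi /\
  mult_op phi = to_hardy (mu := mu) \o A \o
    adjoint (@sym_inner R n mu) (@hardy_inner R n mu) (to_hardy (mu := mu)).
Proof.
split=> [Aphi|[phim phiA] x l].
  have phim := multiplies_multiplier Aphi; split=> //.
  apply/funext => f; have [x <-] := to_hardy_surj f.
  apply: val_inj; apply/funext => l /=.
  by rewrite [LHS]mult_opE // (adjoint_to_hardy D0) Aphi.
have := congr1 (fun g : hardy mu -> hardy mu => g (to_hardy x) l) phiA.
by rewrite /= mult_opE // (adjoint_to_hardy D0).
Qed.

(** A y^(p) is a product of shifts of class [p] applied to [A one], and those shifts send y^(k) to
    y^(k+p). *)
Lemma multiplies_convolution (phi : D -> R[i]^o) A (x : H) q : multiplies phi A ->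
  sym_coef mu (A x) q =
    \sum_(kp \in [set kp : multi_index * multi_index | kp.1 + kp.2 = q])
      sym_coef mu (A one) kp.1 * sym_coef mu x kp.2.
Proof.
move=> Aphi; rewrite (multiplies_coef x q Aphi); set F := low_degree _ _.
have AY p : sym_coef mu (A (Y p)) q =
    \sum_(k <- F) sym_coef mu (A one) k * (k + p == q)%:R.
  have [a ap] := word_class_surj p.
  have -> : A (Y p) = word_shift a (A one).
    rewrite -ap -word_shift_one; apply: (sym_eval_inj D0); apply/funext => l.
    by rewrite Aphi !multiplies_word_shift Aphi mulrCA.
  rewrite (multiplies_coef _ q (multiplies_word_shift a)); apply: eq_bigr => k _.
  by rewrite word_shift_basis ap sym_coef_basis addrC.
have sub (k p : multi_index) : k + p = q -> (degree k <= degree q)%N /\ (degree p <= degree q)%N.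
  move=> <-; have -> : degree (k + p) = (degree k + degree p)%N.
    by rewrite /degree -big_split; apply: eq_bigr => i _; rewrite ffunE.
  by rewrite leq_addr leq_addl.
set S := [set kp : multi_index * multi_index | _].
have Sfin : finite_set S.
  apply: (@sub_finite_set _ _ ([set` F] `*` [set` F])); last first.
    by apply: finite_setX; exact: finite_fset.
  by move=> [k p] /sub[kq pq]; split; rewrite /= mem_low_degree.
rewrite fsbig_finite //.
(* Both parts of a pair with k + p = q have degree at most that of [q], so the double sum over [F]
   meets all of them. *)
transitivity (\sum_(kp <- [seq (k, p) | k <- F, p <- F])
    if kp.1 + kp.2 == q then sym_coef mu (A one) kp.1 * sym_coef mu x kp.2 else 0).
  rewrite big_allpairs exchange_big; apply: eq_bigr => p _.
  rewrite AY mulr_sumr; apply: eq_bigr => k _ /=.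
  by case: eqP => _; rewrite ?mulr1 ?mulr0 // mulrC.
rewrite -big_mkcond -big_filter; apply/perm_big/uniq_perm; [|exact: fset_uniq|].
  rewrite filter_uniq // allpairs_uniq ?fset_uniq //.
  by move=> [? ?] [? ?].
move=> [k p]; rewrite mem_filter in_fset_set // /S.
apply/andP/idP => /= [[/eqP kp _]|]; first by rewrite inE.
rewrite inE /= => kp; rewrite kp; split=> //.
by have [kq pq] := sub _ _ kp; apply/allpairsP; exists (k, p); rewrite /= !mem_low_degree.
Qed.

End multipliers.

Theorem theorem6p2 (R : realType) (n : nat) (mu : weight R n) :
  nbhs (0 : 'rV[R[i]^o]_n) (weight_domain mu) ->
  let W := left_shift mu in
  let B := sym_shift (mu := mu) in
  let dotF := inner (R := R) (T := word n) in
  let dotS := sym_inner (mu := mu) in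
  let dotH := hardy_inner (mu := mu) in
  let one := vacuum mu in
  [/\ (* (i) *)
      (forall i, multiplier (coordinate (mu := mu) i)) /\
      unitarily_equivalent dotS dotH B (fun i => mult_op (coordinate i)),
      (* (ii) *)
      point_spectrum (fun i => adjoint dotS dotS (B i)) = weight_domain mu /\
      point_spectrum (fun i => adjoint dotF dotF (W i)) = weight_domain mu,
      (* (iii) *)
      (exists! U : symFock mu -> hardy mu, monomial_unitary U) /\
      (forall U : symFock mu -> hardy mu, monomial_unitary U ->
        forall A : symFock mu -> symFock mu,
          commutant B A <->
          exists! phi : weight_domain mu -> R[i]^o,
            multiplier phi /\ mult_op phi = U \o A \o adjoint dotS dotH U),
      (* (iv) *)
      (forall A, commutant B A ->
        [/\ forall A', commutant B A' -> A' one = A one -> A' = A,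
            exists! c, sym_expansion (A one) c &
            forall (c a : multi_index n -> R[i]) (zeta : symFock mu),
              sym_expansion (A one) c -> sym_expansion zeta a ->
              sym_expansion (A zeta) (fun q =>
                \sum_(kp \in [set kp : multi_index n * multi_index n |
                              kp.1 + kp.2 = q]) c kp.1 * a kp.2)]) &
      (* (v) *)
      (forall A c, commutant B A -> sym_expansion (A one) c ->
        exists phi : weight_domain mu -> R[i]^o, power_series c phi /\
          forall l, dotF (A one) (eigen_kernel l) = phi l /\
            exists zl : symFock mu, symFock_val zl = eigen_kernel l /\
              adjoint dotS dotS A zl = (phi l)^* *: zl)].
Proof.
move=> D0 W B dotF dotS dotH one.
have expand (x : symFock mu) : sym_expansion x (sym_coef mu x) by apply/sym_expansionP.
have shift_mult i : multiplies (coordinate (mu := mu) i) (B i).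
  by move=> x l; exact: sym_eval_shift.
split.
- have coord_mult i : multiplier (coordinate (mu := mu) i).
    exact: multiplies_multiplier (shift_mult i).
  split=> //; exists (to_hardy (mu := mu)); first exact: to_hardy_unitary.
  move=> i; apply/funext => x; apply: val_inj; apply/funext => l.
  by rewrite [RHS]mult_opE //; exact: shift_mult.
- by split; [exact: point_spectrum_sym_shift|exact: point_spectrum_left_shift].
- split.
    exists (to_hardy (mu := mu)); split; first exact: to_hardy_monomial_unitary.
    by move=> U /(monomial_unitary_unique D0).
  move=> U /(monomial_unitary_unique D0) -> A; split.
    move=> /(commutant_multiplies D0) Aphi; exists (sym_eval (A one)).
    split; first exact/(multipliesE D0).
    by move=> phi /(multipliesE D0) /multiplies_one.
  by move=> [phi [/(multipliesE D0) /(multiplies_commutant D0)]].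
- move=> A /(commutant_multiplies D0) Aphi; split.
  + move=> A' /(commutant_multiplies D0) A'phi AA'; apply/funext => x.
    apply: (sym_eval_inj D0); apply/funext => l.
    by rewrite A'phi Aphi AA'.
  + exists (sym_coef mu (A one)); split=> // c.
    by move=> /sym_expansionP.
  + move=> c a zeta /sym_expansionP -> /sym_expansionP ->.
    apply/sym_expansionP/funext => q.
    by rewrite (multiplies_convolution D0 zeta q Aphi).
- move=> A c /(commutant_multiplies D0) Aphi /sym_expansionP ->.
  exists (sym_eval (A one)); split; first exact: sym_eval_power_series.
  move=> l; split=> //; exists (SymFock (eigen_kernel_sym l)); split=> //.
  (* The identity <A x, z> = phi(l) <x, z> for all [x] says that conj(phi(l)) z represents the
     functional. *)
  apply: adjointE; last exact: sym_inner_nondegenerate.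
  move=> x; rewrite /dotS /sym_inner [LHS]innerZr conjCK.
  exact/esym/Aphi.
Qed.
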